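(* Let $G$ be a connected closed graph on $[n]$. Then $\operatorname{reg}(S/J_G)=n-1$ if and only if $G$ is a line graph (i.e. a path on the $n$ vertices).
   Context: Let $K$ be a field and $S=K[x_1,\ldots,x_n,y_1,\ldots,y_n]$ the standard graded polynomial ring in $2n$ variables. Graphs are finite and simple. For a graph $G$ on $[n]=\{1,\ldots,n\}$ with edge set $E(G)$, the binomial edge ideal of $G$ is $J_G=(x_iy_j-x_jy_i : \{i,j\}\in E(G),\ i<j)\subset S$, and $\operatorname{reg}$ denotes Castelnuovo--Mumford regularity over $S$. The graph $G$ is closed with respect to its given labeling if for all distinct edges $\{i,j\},\{i,k\}\in E(G)$ such that either $i<j$ and $i<k$, or $i>j$ and $i>k$, one has $\{j,k\}\in E(G)$. $G$ is closed if it is closed with respect to some labeling of its vertices. ''Line graph'' here means a path graph: a graph whose vertices can be ordered $v_1,\ldots,v_n$ so that its edges are exactly $\{v_i,v_{i+1}\}$, $1\le i\le n-1$ (not the line graph of another graph). *)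

(* Defs.v *)
From HB Require Import structures.
From mathcomp Require Import all_boot all_order all_algebra all_fingroup.
From mathcomp Require Import mpoly.
Set Implicit Arguments.
Unset Strict Implicit.
Unset Printing Implicit Defensive.
Import Order.TTheory GRing.Theory Num.Theory.
Local Open Scope ring_scope.

(* Graphs on [n] are symmetric irreflexive relations on 'I_n; the vertex set  *)
(* {1, .., n} is shifted to {0, .., n-1}, which preserves the order.          *)

Definition closed_labeling n (e : rel 'I_n) : Prop :=
  forall i j k : 'I_n, e i j -> e i k -> j != k ->
    ((i < j)%N && (i < k)%N) || ((j < i)%N && (k < i)%N) -> e j k.

Definition closed_graph n (e : rel 'I_n) : Prop :=
  exists s : 'S_n, closed_labeling (fun i j => e (s i) (s j)).

Definition connected_graph n (e : rel 'I_n) : Prop :=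
  forall i j : 'I_n, connect e i j.

Definition path_graph n (e : rel 'I_n) : Prop :=
  exists v : 'S_n, forall i j : 'I_n,
    e (v i) (v j) = (j == i.+1 :> nat) || (i == j.+1 :> nat).

Section BinomialEdgeIdeal.
Variables (K : fieldType) (n : nat).

Definition xvar (i : 'I_n) : {mpoly K[n + n]} := 'X_(lshift n i).
Definition yvar (i : 'I_n) : {mpoly K[n + n]} := 'X_(rshift n i).

Definition binomial_edge_ideal (e : rel 'I_n) (f : {mpoly K[n + n]}) : Prop :=
  exists c : 'I_n -> 'I_n -> {mpoly K[n + n]},
    f = \sum_(i < n) \sum_(j < n | (i < j)%N && e i j)
          c i j * (xvar i * yvar j - xvar j * yvar i).

End BinomialEdgeIdeal.

Section Regularity.
Variables (K : fieldType) (N : nat).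
Local Notation S := {mpoly K[N]}.

(* The library's [d.-homog] with the degree in int, as shifts are integers;   *)
(* 0 is homogeneous of every degree and is the only such polynomial when      *)
(* z < 0.                                                                     *)
Definition homog_of_degree (z : int) (p : S) : Prop :=
  {in msupp p, forall m, (mdeg m)%:Z = z}.

(* A minimal graded free resolution of S / J,                                 *)
(*   ... -> F_2 -> F_1 -> F_0 -> S / J -> 0,  F_i = \bigoplus_k S(- d_i k),   *)
(* with elements of F_i written as row vectors, F_(i+1) -> F_i being          *)
(* v |-> v *m D_i and F_0 -> S / J being v |-> v *m g modulo J.               *)
(* All maps are homogeneous of degree 0.                                      *)
Record min_graded_resolution (J : S -> Prop) := MinGradedResolution {
  res_rank : nat -> nat;
  res_shift : forall i, 'I_(res_rank i) -> int;
  res_diff : forall i, 'M[S]_(res_rank i.+1, res_rank i);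
  res_aug : 'cV[S]_(res_rank 0);
  res_aug_homog : forall k, homog_of_degree (res_shift k) (res_aug k 0);
  res_diff_homog : forall i k l,
    homog_of_degree (res_shift k - res_shift l) (res_diff i k l);
  res_aug_surj : forall f : S,
    exists v : 'rV_(res_rank 0), J (f - (v *m res_aug) 0 0);
  res_exact0 : forall v : 'rV_(res_rank 0),
    J ((v *m res_aug) 0 0) <-> exists w, v = w *m res_diff 0;
  res_exactS : forall i (v : 'rV_(res_rank i.+1)),
    v *m res_diff i = 0 <-> exists w, v = w *m res_diff i.+1;
  (* the image of F_(i+1) lies in (x_1, .., x_N) F_i *)
  res_minimal : forall i k l, (res_diff i k l)@_0%MM = 0
}.

(* reg (S / J) = r, i.e. r = max {j - i | S(-j) is a summand of F_i}.  This is *)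
(* a relation because S / J = 0 has no (finite) regularity.                    *)
Definition has_regularity (J : S -> Prop) (r : int) : Prop :=
  exists F : min_graded_resolution J,
    (forall i (k : 'I_(res_rank F i)), res_shift k - i%:Z <= r) /\
    (exists i (k : 'I_(res_rank F i)), res_shift k - i%:Z = r).

End Regularity.

(* Main.v *)
Require Import Defs.
From HB Require Import structures.
From mathcomp Require Import all_boot all_order all_algebra all_fingroup.
From mathcomp Require Import ring zify.
From mathcomp Require mpoly.
Set Implicit Arguments.
Unset Strict Implicit.
Unset Printing Implicit Defensive.
Import Order.TTheory GRing.Theory Num.Theory.
Local Open Scope ring_scope.

(** The regularity of [S / J_G] is bounded through Koszul homology, which
computes [Tor (S / J, K)]: [koszul_reg J r] says that [Tor_i (S / J, K)] vanishes
in degrees above [i + r].  The long exact sequences attached to a variable [z]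
become three rules on this property ([koszul_reg_divide], [koszul_reg_adjoin],
[koszul_reg_colon]), and [resolution_shift_le] turns the property into a bound on
the shifts of any minimal resolution.

A labeling for which a connected graph is closed makes it an interval graph: an
edge [i < j] forces edges from [i] and from [j] to everything in between
([closed_labeling_interval]).  For such a graph the last vertex [m] gives a
variable [x_m] that is regular modulo [J_G]; killing it leaves the ideal of the
graph on the earlier vertices plus [y_m * (x_i : i adjacent to m)].  Taking the
colon by [y_m] and adding [y_m] then leads to ideals of the same mixed kind on
fewer vertices ([mixed_gen]), part binomial and part monomial.  Following the
recursion, each colon uses up a vertex that is the least neighbour of some later
vertex, so the regularity is at most the number of such vertices among the first
[n - 1] ([koszul_reg_binom]).  If this number is [n - 1], the least neighbour of
each vertex [j > 0] has to be [j - 1], and the graph is a path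
([num_lowest_path]).  Otherwise the regularity is below [n - 1].

Conversely, the [n - 1] quadrics of a path form a regular sequence
([binom_nzd]), and each of them raises the regularity by one, since the mapping
cone of the multiplication by a regular quadric on a minimal resolution is again
minimal ([has_regularity_adjoin]). *)

(** * Ideals as predicates *)

Section Ideals.
Variable R : comNzRingType.
Implicit Types (J G : R -> Prop) (p q a f : R).

Record is_ideal J : Prop := IsIdeal {
  ideal0 : J 0;
  idealD : forall p q, J p -> J q -> J (p + q);
  idealM : forall a p, J p -> J (a * p)
}.

Lemma idealN J p : is_ideal J -> J p -> J (- p).
Proof. by move=> iJ Jp; rewrite -mulN1r; apply: idealM. Qed.

Lemma idealB J p q : is_ideal J -> J p -> J q -> J (p - q).
Proof. by move=> iJ Jp Jq; apply: idealD => //; apply: idealN. Qed.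

Lemma ideal_mulr J a p : is_ideal J -> J p -> J (p * a).
Proof. by move=> iJ Jp; rewrite mulrC; apply: idealM. Qed.

Lemma ideal_sum J (I : Type) (r : seq I) (P : pred I) (F : I -> R) :
  is_ideal J -> (forall i, P i -> J (F i)) -> J (\sum_(i <- r | P i) F i).
Proof.
by move=> iJ JF; apply: big_ind => //; [apply: ideal0 | move=> *; apply: idealD].
Qed.

Inductive ideal_gen G : R -> Prop :=
| ideal_gen0 : ideal_gen G 0
| ideal_genD a g p : G g -> ideal_gen G p -> ideal_gen G (a * g + p).

Lemma ideal_gen_mem G g : G g -> ideal_gen G g.
Proof.
by move=> Gg; have := ideal_genD 1 Gg (ideal_gen0 G); rewrite mul1r addr0.
Qed.

Lemma ideal_gen_ideal G : is_ideal (ideal_gen G).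
Proof.
split; first exact: ideal_gen0.
- move=> p q gp gq; elim: gp => [|a g p' Gg _ IH]; first by rewrite add0r.
  by rewrite -addrA; apply: ideal_genD.
- move=> a p; elim=> [|b g p' Gg _ IH]; first by rewrite mulr0; apply: ideal_gen0.
  by rewrite mulrDr mulrA; apply: ideal_genD.
Qed.

Lemma ideal_gen_le G J : is_ideal J -> (forall g, G g -> J g) ->
  forall p, ideal_gen G p -> J p.
Proof.
move=> iJ GJ p; elim=> [|a g p' Gg _ IH]; first exact: ideal0.
by apply: idealD => //; apply: idealM => //; apply: GJ.
Qed.

Definition adjoin J f p : Prop := exists a, J (p - a * f).

Lemma adjoin_ideal J f : is_ideal J -> is_ideal (adjoin J f).
Proof.
move=> iJ; split.
- by exists 0; rewrite mul0r subrr; apply: ideal0.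
- move=> p q [a Ja] [b Jb]; exists (a + b).
  by rewrite mulrDl opprD addrACA; apply: idealD.
- by move=> c p [a Ja]; exists (c * a); rewrite -mulrA -mulrBr; apply: idealM.
Qed.

Lemma adjoin_sub J f p : J p -> adjoin J f p.
Proof. by move=> Jp; exists 0; rewrite mul0r subr0. Qed.

Lemma adjoin_gen J f : is_ideal J -> adjoin J f f.
Proof. by move=> iJ; exists 1; rewrite mul1r subrr; apply: ideal0. Qed.

Lemma adjoin_le J J' f : is_ideal J' ->
  (forall p, J p -> J' p) -> J' f -> forall p, adjoin J f p -> J' p.
Proof.
move=> iJ' JJ' J'f p [a Ja]; rewrite -(subrK (a * f) p).
by apply: idealD => //; [apply: JJ' | apply: idealM].
Qed.

Definition colon J f p : Prop := J (p * f).

Lemma colon_ideal J f : is_ideal J -> is_ideal (colon J f).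
Proof.
move=> iJ; split; rewrite /colon; first by rewrite mul0r; apply: ideal0.
- by move=> p q; rewrite mulrDl; apply: idealD.
- by move=> a p; rewrite -mulrA; apply: idealM.
Qed.

Definition nonzerodivisor J f : Prop := forall p, J (p * f) -> J p.

Definition mx_in J m n (U : 'M[R]_(m, n)) : Prop := forall i j, J (U i j).

Section MxIn.
Variables (J : R -> Prop) (iJ : is_ideal J).

Lemma mx_in0 m n : mx_in J (0 : 'M[R]_(m, n)).
Proof. by move=> i j; rewrite mxE; apply: ideal0. Qed.

Lemma mx_inD m n (U V : 'M[R]_(m, n)) : mx_in J U -> mx_in J V -> mx_in J (U + V).
Proof. by move=> JU JV i j; rewrite mxE; apply: idealD. Qed.

Lemma mx_inN m n (U : 'M[R]_(m, n)) : mx_in J U -> mx_in J (- U).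
Proof. by move=> JU i j; rewrite mxE; apply: idealN. Qed.

Lemma mx_inB m n (U V : 'M[R]_(m, n)) : mx_in J U -> mx_in J V -> mx_in J (U - V).
Proof. by move=> JU JV; apply: mx_inD => //; apply: mx_inN. Qed.

Lemma mx_inMl m n k (A : 'M[R]_(k, m)) (U : 'M[R]_(m, n)) :
  mx_in J U -> mx_in J (A *m U).
Proof. by move=> JU i j; rewrite mxE; apply: ideal_sum => // l _; apply: idealM. Qed.

Lemma mx_inMr m n k (A : 'M[R]_(n, k)) (U : 'M[R]_(m, n)) :
  mx_in J U -> mx_in J (U *m A).
Proof. by move=> JU i j; rewrite mxE; apply: ideal_sum => // l _; apply: ideal_mulr. Qed.

Lemma mx_inZ m n a (U : 'M[R]_(m, n)) : mx_in J U -> mx_in J (a *: U).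
Proof. by move=> JU i j; rewrite mxE; apply: idealM. Qed.

Lemma mx_in_adjoin f m n (U : 'M[R]_(m, n)) :
  mx_in (adjoin J f) U -> exists V, mx_in J (U - f *: V).
Proof.
move=> JU.
have /fin_all_exists[c cP] i : exists c : 'I_n -> R, forall j, J (U i j - c j * f).
  by apply: (fin_all_exists (P := fun j c => J (U i j - c * f))) => j; apply: JU.
by exists (\matrix_(i, j) c i j) => i j; rewrite !mxE mulrC; apply: cP.
Qed.

Lemma mx_in_nzd f m n (U : 'M[R]_(m, n)) :
  nonzerodivisor J f -> mx_in J (f *: U) -> mx_in J U.
Proof. by move=> fP JU i j; apply: fP; rewrite mulrC; have := JU i j; rewrite mxE. Qed.

End MxIn.

End Ideals.

Lemma mx_exists_rows (R : comNzRingType) m n k (P : 'rV[R]_n -> 'rV[R]_k -> Prop)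
    (U : 'M[R]_(m, n)) :
  (forall i, exists w, P (row i U) w) ->
  exists W : 'M[R]_(m, k), forall i, P (row i U) (row i W).
Proof.
by move=> /fin_all_exists[f fP]; exists (\matrix_i f i) => i; rewrite rowK.
Qed.

Lemma col_mulmx (R : comNzRingType) m n k (A : 'M[R]_(m, n)) (B : 'M_(n, k)) j :
  col j (A *m B) = A *m col j B.
Proof. by rewrite !colE mulmxA. Qed.

(** * The Koszul complex of a sequence *)

Section Koszul.
Variable R : comNzRingType.
Implicit Types (s : seq R) (z p : R).

Fixpoint koszul_dim (s : seq R) : nat :=
  if s is _ :: s' then (koszul_dim s' + koszul_dim s')%N else 1%N.

(** The differential of the whole complex, with the homological degree forgotten,
acting on column vectors from the left.  The block form presents the complex of
[z :: s'] as the cone of [z] on the complex of [s'].  With the differential acting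
on the left, the maps of a resolution, which act on the right, commute with it by
associativity. *)
Fixpoint koszul (s : seq R) : 'M[R]_(koszul_dim s) :=
  if s is z :: s' then block_mx (koszul s') z%:M 0 (- koszul s') else 0.

(** The coordinate on the part of homological degree 0; its transpose is the
inclusion of that part. *)
Fixpoint koszul_aug (s : seq R) : 'rV[R]_(koszul_dim s) :=
  if s is z :: s' then row_mx (koszul_aug s') 0 else 1%:M.

Lemma koszul_sq s : koszul s *m koszul s = 0.
Proof.
elim: s => [|z s IH] /=; first by rewrite mul0mx.
rewrite mulmx_block !mul0mx !mulmx0 !mulmxN mulNmx opprK IH !addr0.
by rewrite scalar_mxC subrr -[RHS]block_mx0 ?addr0.
Qed.

Lemma koszul_aug_tr s : koszul s *m (koszul_aug s)^T = 0.
Proof.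
elim: s => [|z s IH] /=; first by rewrite mul0mx.
by rewrite tr_row_mx trmx0 mul_block_col IH !mulmx0 mul0mx !addr0 col_mx0.
Qed.

Lemma koszul_aug_aug s : koszul_aug s *m (koszul_aug s)^T = 1%:M.
Proof.
elim: s => [|z s IH] /=; first by rewrite trmx1 mulmx1.
by rewrite tr_row_mx mul_row_col IH mul0mx addr0.
Qed.

Definition in_seq (s : seq R) : R -> Prop := ideal_gen (fun g => g \in s).

Lemma in_seq_ideal s : is_ideal (in_seq s).
Proof. exact: ideal_gen_ideal. Qed.

Lemma in_seq_consr z s p : in_seq s p -> in_seq (z :: s) p.
Proof.
apply: ideal_gen_le; first exact: in_seq_ideal.
by move=> g gs; apply: ideal_gen_mem; rewrite inE gs orbT.
Qed.

Lemma in_seq_consP z s p : in_seq (z :: s) p -> adjoin (in_seq s) z p.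
Proof.
apply: ideal_gen_le; first by apply: adjoin_ideal; apply: in_seq_ideal.
move=> g; rewrite inE => /orP[/eqP->|gs]; last exact/adjoin_sub/ideal_gen_mem.
by apply: adjoin_gen; apply: in_seq_ideal.
Qed.

Lemma koszul_aug_in s : mx_in (in_seq s) (koszul_aug s *m koszul s).
Proof.
elim: s => [|z s IH] /=.
  by rewrite mulmx0; apply: mx_in0; apply: in_seq_ideal.
rewrite mul_row_block !mul0mx !addr0 => i j; rewrite mxE.
case: splitP => k _; first exact/in_seq_consr/IH.
rewrite scalar_mxC mul_scalar_mx mxE; apply: ideal_mulr; first exact: in_seq_ideal.
by apply: ideal_gen_mem; rewrite inE eqxx.
Qed.

(** Exterior multiplication by the basis vector of [z] is a homotopy from the
multiplication by [z] to zero, so that [z] annihilates Koszul homology. *)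
Lemma koszul_homotopy s z : z \in s ->
  exists h, koszul s *m h + h *m koszul s = z%:M.
Proof.
elim: s => [//|y s IH]; rewrite inE => /orP[/eqP->|/IH[h hP]] /=.
  exists (block_mx 0 0 1%:M 0).
  rewrite !mulmx_block !mul0mx !mulmx0 !mul1mx !mulmx1 !add0r.
  by rewrite add_block_mx !addr0 !add0r addrC subrr -scalar_mx_block.
exists (block_mx h 0 0 (- h)).
rewrite !mulmx_block !mul0mx !mulmx0 !addr0 !add0r !mulmxN !mulNmx !opprK.
rewrite add_block_mx !addr0 hP -scalar_mxC addNr.
by rewrite -scalar_mx_block.
Qed.

Fixpoint regular_seq (s : seq R) : Prop :=
  if s is z :: s' then nonzerodivisor (in_seq s') z /\ regular_seq s' else True.

(** For a regular sequence the homology is concentrated in homological degree 0,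
where it is the quotient by [s]; hence the augmentation is the only obstruction
to being a boundary.  The induction is the long exact sequence of the cone. *)
Lemma koszul_exact s : regular_seq s -> forall u : 'cV[R]_(koszul_dim s),
  koszul s *m u = 0 -> mx_in (in_seq s) (koszul_aug s *m u) ->
  exists w, u = koszul s *m w.
Proof.
elim: s => [|z s IH] /=.
  move=> _ u _; rewrite mul1mx => /(_ 0 0) u0; exists 0.
  rewrite mul0mx; apply/matrixP=> i j; rewrite !ord1 mxE.
  by case E: _ / u0 => // [a g p].
move=> [zreg sreg] u; rewrite -[u]vsubmxK; move: (usubmx u) (dsubmx u) => a b.
rewrite mul_block_col mul0mx add0r mul_row_col mul0mx addr0 mulNmx.
rewrite mul_scalar_mx -[0 in X in X -> _]col_mx0 => /eq_col_mx[abE /eqP].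
rewrite oppr_eq0 => /eqP b0 aug_a.
have augb : mx_in (in_seq s) (koszul_aug s *m b).
  apply: mx_in_nzd zreg _; rewrite scalemxAr (_ : z *: b = - (koszul s *m a)).
    rewrite mulmxN mulmxA; apply: mx_inN; first exact: in_seq_ideal.
    apply: mx_inMr; first exact: in_seq_ideal.
    exact: koszul_aug_in.
  by apply/eqP; rewrite -addr_eq0 addrC abE.
have [w bE] := IH sreg b b0 augb.
have [|c cP] := @mx_in_adjoin _ (in_seq s) z _ _ (koszul_aug s *m (a + z *: w)).
  rewrite mulmxDr; apply: mx_inD => [|i j|].
  - by apply: adjoin_ideal; apply: in_seq_ideal.
  - exact/in_seq_consP/aug_a.
  - move=> i j; rewrite -scalemxAr mxE; apply: ideal_mulr.
      by apply: adjoin_ideal; apply: in_seq_ideal.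
    by apply: adjoin_gen; apply: in_seq_ideal.
(* [w] is only determined up to a multiple of the inclusion of degree 0; the
   correction by [c] brings the augmentation of [a - z *: w'] into [in_seq s]. *)
pose w' := - w + (koszul_aug s)^T *m c.
have bE' : b = - (koszul s *m w').
  by rewrite /w' mulmxDr mulmxA koszul_aug_tr mul0mx addr0 mulmxN opprK.
have [||v vE] := IH sreg (a - z *: w').
- by rewrite mulmxBr -scalemxAr -[koszul s *m w']opprK -bE' scalerN opprK.
- rewrite /w' scalerDr scalerN opprD opprK addrA mulmxBr -scalemxAr.
  by rewrite mulmxA koszul_aug_aug mul1mx.
exists (col_mx v w').
rewrite mul_block_col mul0mx add0r mul_scalar_mx -vE subrK mulNmx.
by rewrite -bE'.
Qed.

End Koszul.

(** * Homogeneous parts *)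

Section Graded.
Import mpoly.
Variables (K : fieldType) (N : nat).
Local Notation S := {mpoly K[N]}.
Local Notation homog_part d := (pihomog (mdeg (n:=N)) d).
Implicit Types (J : S -> Prop) (p q a f : S).

Lemma homog_partM d e a f : f \is e.-homog ->
  homog_part (d + e) (a * f) = homog_part d a * f.
Proof.
move=> fe; rewrite {1}(pihomog_partitionE (mf := mdeg (n:=N)) (leq_addr d.+1 (msize a))).
rewrite mulr_suml raddf_sum /=.
have d_lt : (d < msize a + d.+1)%N by lia.
rewrite (bigD1 (Ordinal d_lt)) //= big1 ?addr0.
  by rewrite pihomog_dE //; apply: dhomogM => //; apply: pihomogP.
move=> i; rewrite -val_eqE /= => ne_id.
by apply: (@pihomog_ne0 _ _ _ (i + e)%N); [lia | apply: dhomogM => //; apply: pihomogP].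
Qed.

Lemma homog_partM0 d e a f : f \is e.-homog -> (d < e)%N ->
  homog_part d (a * f) = 0.
Proof.
move=> fe d_lt; rewrite (pihomog_partitionE (mf := mdeg (n:=N)) (leqnn (msize a))).
rewrite mulr_suml raddf_sum /= big1 // => i _.
by apply: (@pihomog_ne0 _ _ _ (i + e)%N); [lia | apply: dhomogM => //; apply: pihomogP].
Qed.

Definition graded J : Prop := forall d p, J p -> J (homog_part d p).

Lemma graded_ideal_gen (G : S -> Prop) :
  (forall g, G g -> exists e, g \is e.-homog) -> graded (ideal_gen G).
Proof.
move=> Ghom d p; elim=> [|a g q Gg _ IH].
  by rewrite raddf0; apply: ideal_gen0.
rewrite raddfD /=; have [e ge] := Ghom g Gg.
have [d_lt|e_le] := ltnP d e; first by rewrite (homog_partM0 _ ge) // add0r.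
by rewrite -(subnK e_le) (homog_partM _ _ ge) subnK //; apply: ideal_genD.
Qed.

Lemma graded_adjoin J f e : graded J -> f \is e.-homog -> graded (adjoin J f).
Proof.
move=> gJ fe d p [a Ja]; have := gJ d _ Ja; rewrite raddfB /=.
have [d_lt|e_le] := ltnP d e.
  by rewrite (homog_partM0 _ fe) // subr0; apply: adjoin_sub.
rewrite -{2}(subnK e_le) (homog_partM _ _ fe) => Jd.
by exists (homog_part (d - e) a).
Qed.

Lemma koszul_homog (s : seq S) : (forall z, z \in s -> z \is 1.-homog) ->
  forall i j, koszul s i j \is 1.-homog.
Proof.
elim: s => [|z s IH] /= s1 i j; first by rewrite mxE dhomog0.
have {}IH := IH (fun y ys => s1 y (mem_behead (s := z :: s) ys)).
rewrite mxE; case: splitP => i' _; rewrite mxE; case: splitP => j' _.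
- exact: IH.
- by rewrite mxE; case: eqP => _; rewrite ?mulr1n ?mulr0n ?dhomog0 ?s1 ?inE ?eqxx.
- by rewrite mxE dhomog0.
- by rewrite mxE rpredN; apply: IH.
Qed.

Lemma koszul_homog_part (s : seq S) : (forall z, z \in s -> z \is 1.-homog) ->
  forall d n (U : 'M[S]_(koszul_dim s, n)),
  map_mx (homog_part d.+1) (koszul s *m U) = koszul s *m map_mx (homog_part d) U.
Proof.
move=> s1 d n U; apply/matrixP => i j; rewrite !mxE raddf_sum /=; apply: eq_bigr => k _.
rewrite mxE [in LHS]mulrC -[d.+1]addn1 (homog_partM _ _ (koszul_homog s1 i k)).
by rewrite mulrC.
Qed.

End Graded.

(** * Division by a variable *)

Section VarFree.
Import mpoly.
Variables (K : fieldType) (N : nat).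
Local Notation S := {mpoly K[N]}.
Implicit Types (J : S -> Prop) (p q a f : S) (z : 'I_N).

(** [(p - p|_{z = 0}) / z], given by shifting the coefficients. *)
Definition divvar (z : 'I_N) p : S :=
  \sum_(m : 'X_{1..N < msize p}) p@_(m + U_(z)) *: 'X_[m].

Lemma mcoeff_divvar z p m : (divvar z p)@_m = p@_(m + U_(z)).
Proof.
have [m_lt|m_ge] := ltnP (mdeg m) (msize p).
  by rewrite (mcoeff_mpoly (fun m => p@_(m + U_(z))) m_lt).
have -> : p@_(m + U_(z)) = 0.
  by apply/memN_msupp_eq0/msize_mdeg_ge; rewrite mdegD; lia.
rewrite raddf_sum big1 // => k _ /=; rewrite mcoeffZ mcoeffX.
case: eqP => [km|_]; last by rewrite mulr0.
by move: m_ge; rewrite -km leqNgt bmdeg.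
Qed.

Lemma divvar_is_linear z : linear (divvar z).
Proof.
move=> c p q; apply/mpolyP => m.
by rewrite mcoeffD mcoeffZ !mcoeff_divvar mcoeffD mcoeffZ.
Qed.

HB.instance Definition _ z := GRing.isLinear.Build K S S _ (divvar z) (divvar_is_linear z).

Lemma divvarMX z p : divvar z (p * 'X_z) = p.
Proof. by apply/mpolyP => m; rewrite mcoeff_divvar addmC mcoeffMX. Qed.

Lemma mcoeffMXU (z : 'I_N) p (m : 'X_{1..N}) : m z = 0%N -> (p * 'X_z)@_m = 0.
Proof.
move=> mz; apply: memN_msupp_eq0; rewrite (perm_mem (msuppMX _ _)).
by apply/mapP=> -[k _ E]; move: mz; rewrite E mnmDE mnm1E eqxx.
Qed.

Lemma msize_divvar z p : p != 0 -> (msize (divvar z p) < msize p)%N.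
Proof.
move=> p0; have [->|q0] := eqVneq (divvar z p) 0.
  by rewrite mmeasure0 lt0n mmeasure_poly_eq0.
rewrite -(mlead_deg q0); have := mlead_supp q0.
rewrite mcoeff_msupp mcoeff_divvar -mcoeff_msupp => /msize_mdeg_lt.
by rewrite mdegD mdeg1 addn1.
Qed.

(** [p] does not involve the variable [z].  Phrased as linearity of [divvar z]
over [p], this is preserved by sums and products for formal reasons. *)
Definition varfree z p : Prop := forall a, divvar z (a * p) = divvar z a * p.

Lemma varfreeX z i : i != z -> varfree z 'X_i.
Proof.
move=> ne_iz a; apply/mpolyP=> m; rewrite mcoeff_divvar.
have [mi|mi] := eqVneq (m i) 0%N.
  by rewrite !mcoeffMXU // mnmDE mi mnm1E eq_sym (negPf ne_iz).
have -> : m = (m - U_(i) + U_(i))%MM.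
  rewrite submK //; apply/mnm_lepP=> k; rewrite mnm1E.
  by case: eqP => // <-; rewrite lt0n.
set k := (m - U_(i))%MM; rewrite [in RHS](addmC k) mcoeffMX mcoeff_divvar.
by rewrite (addmC k) -addmA mcoeffMX.
Qed.

Lemma varfreeD z p q : varfree z p -> varfree z q -> varfree z (p + q).
Proof. by move=> fp fq a; rewrite mulrDr raddfD /= fp fq mulrDr. Qed.

Lemma varfreeN z p : varfree z p -> varfree z (- p).
Proof. by move=> fp a; rewrite mulrN raddfN /= fp mulrN. Qed.

Lemma varfreeM z p q : varfree z p -> varfree z q -> varfree z (p * q).
Proof. by move=> fp fq a; rewrite mulrA fq fp mulrA. Qed.

Definition setvar0 z p : S := p - divvar z p * 'X_z.

Lemma setvar0_is_zmod z : {morph setvar0 z : p q / p - q}.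
Proof. by move=> p q; rewrite /setvar0 raddfB /=; ring. Qed.

HB.instance Definition _ z := GRing.isZmodMorphism.Build S S (setvar0 z) (setvar0_is_zmod z).

Lemma setvar0MX z p : setvar0 z (p * 'X_z) = 0.
Proof. by rewrite /setvar0 divvarMX subrr. Qed.

Lemma setvar0M z a p : varfree z p -> setvar0 z (a * p) = setvar0 z a * p.
Proof. by move=> fp; rewrite /setvar0 fp; ring. Qed.

(** The property of ideals extended from the polynomial ring in the variables
other than [z] that replaces any bookkeeping of that smaller ring. *)
Definition divvar_stable z J : Prop := forall p, J p -> J (divvar z p).

Lemma divvar_stable_gen z (G : S -> Prop) :
  (forall g, G g -> varfree z g) -> divvar_stable z (ideal_gen G).
Proof.
move=> Gfree p; elim=> [|a g q Gg _ IH]; first by rewrite raddf0; apply: ideal_gen0.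
by rewrite raddfD /= (Gfree g Gg); apply: ideal_genD.
Qed.

Lemma divvar_stable_nzd z J : divvar_stable z J -> nonzerodivisor J 'X_z.
Proof. by move=> st p /st; rewrite divvarMX. Qed.

Lemma setvar0_stable z J p : is_ideal J -> divvar_stable z J -> J p -> J (setvar0 z p).
Proof. by move=> iJ st Jp; apply: idealB => //; apply: ideal_mulr => //; apply: st. Qed.

Lemma regular_seq_vars (l : seq 'I_N) : uniq l ->
  regular_seq [seq 'X_i : S | i <- l].
Proof.
elim: l => [//|i l IH] /= /andP[il ul]; split; last exact: IH.
apply: divvar_stable_nzd; apply: divvar_stable_gen => g /mapP[j jl ->].
by apply: varfreeX; apply: contraNneq il => <-.
Qed.

End VarFree.

(** * Regularity by Koszul homology *)

Section KoszulRegularity.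
Import mpoly.
Variables (K : fieldType) (N : nat).
Local Notation S := {mpoly K[N]}.
Local Notation homog_part d := (pihomog (mdeg (n:=N)) d).
Implicit Types (J : S -> Prop) (p q a f : S) (z : 'I_N).

Definition vars : seq S := [seq 'X_i | i <- enum 'I_N].
Local Notation kos := (koszul vars).

Lemma var_homog z : ('X_z : S) \is 1.-homog.
Proof. by rewrite dhomogX /= mdeg1. Qed.

Lemma vars_homog (y : S) : y \in vars -> y \is 1.-homog.
Proof. by case/mapP=> i _ ->; apply: var_homog. Qed.

Lemma mem_vars i : 'X_i \in vars.
Proof. by apply: map_f; rewrite mem_enum. Qed.

Lemma homog_in_vars d p : p \is d.+1.-homog -> in_seq vars p.
Proof.
move=> ph; rewrite [p]mpolyE big_seq; apply: ideal_sum => [|m mp].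
  exact: in_seq_ideal.
rewrite -mul_mpolyC; apply: idealM; first exact: in_seq_ideal.
have : mdeg m != 0%N by rewrite (dhomog_mf ph mp).
rewrite mdeg_eq0 => /eqP m0; have [i mi] : exists i, m i != 0%N.
  apply/existsP; rewrite -negb_forall; apply/negP => /forallP m00; apply: m0.
  by apply/mnmP => i; rewrite mnm0E; apply/eqP.
rewrite -(@submK _ U_(i)%MM m); last first.
  by apply/mnm_lepP=> k; rewrite mnm1E; case: eqP => // <-; rewrite lt0n.
rewrite mpolyXD; apply: idealM; first exact: in_seq_ideal.
exact/ideal_gen_mem/mem_vars.
Qed.

Lemma coef0_in_vars p : p@_0%MM = 0 -> in_seq vars p.
Proof.
move=> p0; rewrite [p](pihomog_partitionE (mf := mdeg (n:=N)) (leqnn _)).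
apply: ideal_sum => [|i _]; first exact: in_seq_ideal.
case: (i : nat) => [|d]; last by apply: (homog_in_vars (d := d)); apply: pihomogP.
rewrite pihomogE big1_seq; first exact: ideal_gen0.
by move=> m /andP[]; rewrite mdeg_eq0 => /eqP -> _; rewrite p0 scale0r.
Qed.

Lemma in_vars_coef0 p : in_seq vars p -> p@_0%MM = 0.
Proof.
elim=> [|a g q /mapP[i _ ->] _ IH]; first by rewrite mcoeff0.
by rewrite mcoeffD IH addr0 mcoeffMXU // mnm0E.
Qed.

(** For a graded [J], this is the vanishing of [Tor_i (S / J, K)] in degree [i + d]
for all [i] and all [d > r], that is, [reg (S / J) <= r].  The homological degree
does not occur because a Koszul basis vector of homological degree [i] has degree
[i]: an element of degree [i + d] is one with coordinates of degree [d], for every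
[i] at once. *)
Definition koszul_reg J (r : nat) : Prop :=
  forall d (u : 'cV[S]_(koszul_dim vars)), (r < d)%N ->
    (forall i, u i 0 \is d.-homog) -> mx_in J (kos *m u) ->
    exists w, mx_in J (u - kos *m w).

Lemma koszul_reg_le J r r' : (r <= r')%N -> koszul_reg J r -> koszul_reg J r'.
Proof. by move=> rr' TJ d u /(leq_ltn_trans rr'); apply: TJ. Qed.

Lemma koszul_reg_ext J J' r : (forall p, J p <-> J' p) -> koszul_reg J r -> koszul_reg J' r.
Proof.
move=> JJ' TJ d u r_lt uh Ju; have [|w wP] := TJ d u r_lt uh.
  by move=> i j; apply/JJ'/Ju.
by exists w => i j; apply/JJ'/wP.
Qed.

Lemma koszul_reg_zero J : (forall p, J p <-> p = 0) -> koszul_reg J 0.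
Proof.
move=> J0 d u d_gt uh Ju.
have [||w ->] := @koszul_exact _ vars (regular_seq_vars K (enum_uniq _)) u.
- by apply/matrixP => i j; rewrite [RHS]mxE; apply/J0/Ju.
- apply: mx_inMl => [|i j]; first exact: in_seq_ideal.
  by rewrite ord1; apply: (homog_in_vars (d := d.-1)); rewrite prednK.
by exists w => i j; rewrite subrr mxE; apply/J0.
Qed.

Lemma mx_in_homog_part J d m n (U : 'M[S]_(m, n)) :
  graded J -> mx_in J U -> mx_in J (map_mx (homog_part d) U).
Proof. by move=> gJ JU i j; rewrite mxE; apply: gJ. Qed.

Lemma homog_part_col d (u : 'cV[S]_(koszul_dim vars)) :
  (forall i, u i 0 \is d.-homog) -> map_mx (homog_part d) u = u.
Proof. by move=> uh; apply/matrixP=> i j; rewrite mxE ord1 pihomog_dE. Qed.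

Lemma homog_part_scaleX z d m n (U : 'M[S]_(m, n)) :
  map_mx (homog_part d.+1) ('X_z *: U) = 'X_z *: map_mx (homog_part d) U.
Proof.
apply/matrixP => i j; rewrite !mxE mulrC -[d.+1]addn1.
by rewrite (homog_partM _ _ (var_homog z)) mulrC.
Qed.

(** Multiplication by [z] is zero on [Tor] and [S / J] is [z]-torsion-free, so
[Tor (S / J, K)] embeds into [Tor (S / (J + z), K)]. *)
Lemma koszul_reg_divide J z r : is_ideal J -> nonzerodivisor J 'X_z ->
  koszul_reg (adjoin J 'X_z) r -> koszul_reg J r.
Proof.
move=> iJ zJ TJ d u r_lt uh Ju.
have [|w wP] := TJ d u r_lt uh; first by move=> i j; apply/adjoin_sub/Ju.
have [v vP] := mx_in_adjoin wP.
have Jv : mx_in J (kos *m v).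
  apply: (mx_in_nzd zJ); rewrite scalemxAr.
  have -> : kos *m ('X_z *: v) = kos *m u - kos *m (u - kos *m w - 'X_z *: v).
    by rewrite !mulmxBr !mulmxA koszul_sq mul0mx subr0 opprB addrC subrK.
  by apply: mx_inB => //; apply: mx_inMl.
have [h hP] := koszul_homotopy (mem_vars z).
exists (w + h *m v).
have -> : u - kos *m (w + h *m v) = (u - kos *m w - 'X_z *: v) + h *m (kos *m v).
  rewrite -mul_scalar_mx -hP mulmxDl !mulmxA mulmxDr mulmxA !opprD !addrA.
  by rewrite subrK.
by apply: mx_inD => //; apply: mx_inMl.
Qed.

(** From [0 -> (S / J)(-1) -> S / J -> S / (J + z) -> 0]: the shift by one in the
degree is absorbed by the shift by one in the index of [Tor]. *)
Lemma koszul_reg_adjoin J z r : is_ideal J -> graded J -> nonzerodivisor J 'X_z ->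
  koszul_reg J r -> koszul_reg (adjoin J 'X_z) r.
Proof.
move=> iJ gJ zJ TJ d u r_lt uh Ju.
have [v0 v0P] := mx_in_adjoin Ju.
pose v := map_mx (homog_part d) v0.
have vP : mx_in J (kos *m u - 'X_z *: v).
  have := mx_in_homog_part (d.+1) gJ v0P.
  rewrite map_mxB homog_part_scaleX koszul_homog_part; last exact: vars_homog.
  by rewrite (homog_part_col uh).
have vh i : v i 0 \is d.-homog by rewrite mxE pihomogP.
have [|w0 w0P] := TJ d v r_lt vh.
  apply: (mx_in_nzd zJ); rewrite scalemxAr.
  have -> : kos *m ('X_z *: v) = - (kos *m (kos *m u - 'X_z *: v)).
    by rewrite mulmxBr mulmxA koszul_sq mul0mx sub0r opprK.
  by apply: mx_inN => //; apply: mx_inMl.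
have d_gt : (0 < d)%N by apply: leq_trans r_lt.
pose w := map_mx (homog_part d.-1) w0.
have wP : mx_in J (v - kos *m w).
  have := mx_in_homog_part (d.-1.+1) gJ w0P.
  rewrite map_mxB koszul_homog_part; last exact: vars_homog.
  by rewrite prednK // (homog_part_col vh).
have [||w' w'P] := TJ d (u - 'X_z *: w) r_lt.
- move=> i; rewrite !mxE rpredB ?uh // mulrC.
  have := dhomogM (pihomogP (mdeg (n:=N)) d.-1 (w0 i 0)) (var_homog z).
  by rewrite addn1 prednK.
- have -> : kos *m (u - 'X_z *: w) = (kos *m u - 'X_z *: v) + 'X_z *: (v - kos *m w).
    by rewrite mulmxBr -scalemxAr scalerBr addrA subrK.
  by apply: mx_inD => //; apply: mx_inZ.
exists w' => i j; have := w'P i j; rewrite !mxE => Jw.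
by exists (w i j); rewrite mxE (mulrC _ 'X_z) addrAC.
Qed.

(** From [0 -> (S / (J : z))(-1) -> S / J -> S / (J + z) -> 0]. *)
Lemma koszul_reg_colon J z r : is_ideal J -> graded J ->
  koszul_reg (adjoin J 'X_z) r.+1 -> koszul_reg (colon J 'X_z) r ->
  koszul_reg J r.+1.
Proof.
move=> iJ gJ TA TI d u r_lt uh Ju.
have d_gt : (0 < d)%N by apply: leq_trans r_lt.
have [|w0 w0P] := TA d u r_lt uh; first by move=> i j; apply/adjoin_sub/Ju.
have [v0 v0P] := mx_in_adjoin w0P.
pose w := map_mx (homog_part d.-1) w0; pose v := map_mx (homog_part d.-1) v0.
have wP : mx_in J (u - kos *m w - 'X_z *: v).
  have := mx_in_homog_part (d.-1.+1) gJ v0P.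
  rewrite !map_mxB koszul_homog_part ?homog_part_scaleX; last exact: vars_homog.
  by rewrite prednK // (homog_part_col uh).
have [|||w' w'P] := TI d.-1 v.
- by rewrite -ltnS prednK.
- by move=> i; rewrite mxE pihomogP.
- suff JXv : mx_in J ('X_z *: (kos *m v)).
    by move=> i j; have := JXv i j; rewrite mxE mulrC.
  rewrite scalemxAr.
  have -> : kos *m ('X_z *: v) = kos *m u - kos *m (u - kos *m w - 'X_z *: v).
    by rewrite !mulmxBr !mulmxA koszul_sq mul0mx subr0 opprB addrC subrK.
  by apply: mx_inB => //; apply: mx_inMl.
exists (w + 'X_z *: w').
have -> : u - kos *m (w + 'X_z *: w') =
    (u - kos *m w - 'X_z *: v) + 'X_z *: (v - kos *m w').
  by rewrite mulmxDr opprD -scalemxAr scalerBr !addrA subrK.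
by apply: mx_inD => // i j; rewrite mxE mulrC; apply: w'P.
Qed.
End KoszulRegularity.

(** * Koszul homology and minimal resolutions *)

Section Link.
Import mpoly.
Variables (K : fieldType) (N : nat).
Local Notation S := {mpoly K[N]}.
Local Notation homog_part d := (pihomog (mdeg (n:=N)) d).
Local Notation kos := (koszul (vars K N)).
Local Notation eps := (koszul_aug (vars K N)).

Lemma homog_of_degree_nat (d : nat) (p : S) : homog_of_degree d%:Z p <-> p \is d.-homog.
Proof.
split=> [ph|/dhomogP ph m mp]; last by rewrite (ph m mp).
by apply/dhomogP => m mp; have := ph m mp => -[].
Qed.

Lemma homog_of_degree0 z : homog_of_degree z (0 : S).
Proof. by move=> m; rewrite msupp0. Qed.

Lemma homog_of_degreeD z (p q : S) :
  homog_of_degree z p -> homog_of_degree z q -> homog_of_degree z (p + q).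
Proof.
by move=> ph qh m /msuppD_le; rewrite mem_cat => /orP[/ph|/qh].
Qed.

Lemma homog_of_degreeN z (p : S) : homog_of_degree z p -> homog_of_degree z (- p).
Proof. by move=> ph m; rewrite (perm_mem (msuppN p)); apply: ph. Qed.

Lemma homog_of_degreeM y z (p q : S) :
  homog_of_degree y p -> homog_of_degree z q -> homog_of_degree (y + z) (p * q).
Proof.
move=> ph qh m /msuppM_le /allpairsP[[m1 m2] [/= m1p m2q ->]].
by rewrite mdegD PoszD (ph _ m1p) (qh _ m2q).
Qed.

Lemma homog_of_degree_sum z (I : Type) (r : seq I) (P : pred I) (F : I -> S) :
  (forall i, P i -> homog_of_degree z (F i)) ->
  homog_of_degree z (\sum_(i <- r | P i) F i).
Proof.
by move=> Fh; apply: big_ind => //; [apply: homog_of_degree0 | apply: homog_of_degreeD].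
Qed.

Lemma homog_of_degree_neg z (p : S) : z < 0 -> homog_of_degree z p -> p = 0.
Proof.
move=> z_lt ph; apply: msuppnil0; case E: (msupp p) => [//|m s].
by have := ph m; rewrite E inE eqxx => /(_ isT) mz; rewrite -mz in z_lt.
Qed.

Lemma koszul_exact_homog z (v : 'cV[S]_(koszul_dim (vars K N))) :
  (forall i, homog_of_degree z (v i 0)) -> kos *m v = 0 ->
  mx_in (in_seq (vars K N)) (eps *m v) ->
  exists w : 'cV[S]_(koszul_dim (vars K N)),
    (forall i, homog_of_degree (z - 1) (w i 0)) /\ v = kos *m w.
Proof.
move=> vh v0 epsv.
have [w0 w0E] := koszul_exact (regular_seq_vars K (enum_uniq _)) v0 epsv.
have vars1 := @vars_homog K N.
case: z vh => [[|d]|d] vh.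
- exists 0; split=> [i|]; first by rewrite mxE; apply: homog_of_degree0.
  apply/matrixP=> i j; rewrite mulmx0 [RHS]mxE ord1.
  have /homog_of_degree_nat/pihomog_dE <- := vh i.
  rewrite w0E mxE raddf_sum big1 //= => k _.
  by rewrite mulrC (homog_partM0 _ (koszul_homog vars1 _ _)).
- exists (map_mx (homog_part d) w0); split=> [i|].
    rewrite mxE (_ : d.+1%:Z - 1 = d%:Z); last lia.
    by apply/homog_of_degree_nat/pihomogP.
  rewrite -koszul_homog_part // -w0E homog_part_col // => i.
  exact/homog_of_degree_nat.
- exists 0; split=> [i|]; first by rewrite mxE; apply: homog_of_degree0.
  apply/matrixP=> i j; rewrite mulmx0 [RHS]mxE ord1.
  exact: homog_of_degree_neg (vh i).
Qed.

Section Resolution.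
Variables (J : S -> Prop) (iJ : is_ideal J) (F : min_graded_resolution J).

(** Columns of [U] are indexed by the basis of [F_l], so [U] lies in the tensor
product of the Koszul complex with [F_l].  The condition makes its image in the
product with [F_(l - 1)], or with [S / J] for [l = 0], a Koszul cycle. *)
Definition koszul_cycle l : 'M[S]_(koszul_dim (vars K N), res_rank F l) -> Prop :=
  match l with
  | 0 => fun U => mx_in J (kos *m (U *m res_aug F))
  | l'.+1 => fun U => kos *m (U *m res_diff F l') = 0
  end.

Lemma diff_diff l : res_diff F l.+1 *m res_diff F l = 0.
Proof.
apply/row_matrixP => i; rewrite row_mul row0; apply/res_exactS.
by exists (delta_mx 0 i); rewrite -rowE.
Qed.

Lemma diff_aug : mx_in J (res_diff F 0 *m res_aug F).
Proof.
move=> i j; rewrite ord1.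
have -> : (res_diff F 0 *m res_aug F) i 0 = (row i (res_diff F 0) *m res_aug F) 0 0.
  by rewrite -row_mul [RHS]mxE.
by apply/res_exact0; exists (delta_mx 0 i); rewrite -rowE.
Qed.

Lemma koszul_cycle_lift l (U : 'M[S]_(koszul_dim (vars K N), res_rank F l.+1))
    (U' : 'M_(_, res_rank F l)) :
  U *m res_diff F l = kos *m U' -> koszul_cycle U'.
Proof.
case: l U U' => [|l] /= U U' UE; last by rewrite mulmxA -UE -mulmxA diff_diff mulmx0.
by rewrite mulmxA -UE -mulmxA; apply: mx_inMl => //; apply: diff_aug.
Qed.

(** A zigzag in the double complex of the Koszul complex and [F].  The minimality
of [F] puts the image of [U] in the product with [F_(l - 1)] in the kernel of the
augmentation, so it is a Koszul boundary, of some [U'] to which the induction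
applies; for [l = 0] the vanishing of [Tor] takes over.  The total degree minus
the index stays above [r] all the way down. *)
Lemma resolution_split r : koszul_reg J r -> forall l (z : int)
    (U : 'M[S]_(koszul_dim (vars K N), res_rank F l)),
  (forall a g, homog_of_degree (z - res_shift g) (U a g)) ->
  (r + l)%:Z < z -> koszul_cycle U ->
  exists W W', U = kos *m W + W' *m res_diff F l.
Proof.
move=> TJ; elim=> [|l IH] z U Uh z_gt /= cU.
  have uh a : homog_of_degree z ((U *m res_aug F) a 0).
    rewrite mxE; apply: homog_of_degree_sum => g _.
    rewrite -[z](subrK (res_shift g)); apply: homog_of_degreeM => //.
    exact: res_aug_homog.
  case: z {Uh} z_gt uh => [d|//] d_gt uh.
  have [||w wP] := TJ d (U *m res_aug F) _ _ cU; first lia.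
    by move=> i; apply/homog_of_degree_nat/uh.
  have [W WP] : exists W : 'M_(_, res_rank F 0), forall i, J (w i 0 - (row i W *m res_aug F) 0 0).
    have /fin_all_exists[f fP] i := res_aug_surj F (w i 0).
    by exists (\matrix_i f i) => i; rewrite rowK.
  have wWP : mx_in J (w - W *m res_aug F).
    by move=> i j; have := WP i; rewrite -row_mul !mxE ord1.
  have JU : mx_in J ((U - kos *m W) *m res_aug F).
    have -> : (U - kos *m W) *m res_aug F =
      (U *m res_aug F - kos *m w) + kos *m (w - W *m res_aug F).
      by rewrite mulmxBl mulmxBr mulmxA addrA subrK.
    by apply: mx_inD => //; apply: mx_inMl.
  have [|W' W'P] := @mx_exists_rows _ _ _ (res_rank F 1)
    (fun v w' => v = w' *m res_diff F 0) (U - kos *m W).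
    move=> i; apply/res_exact0.
    by have := JU i 0; rewrite -row_mul [X in _ -> J X]mxE.
  exists W, W'; apply/eqP; rewrite addrC -subr_eq; apply/eqP.
  by apply/row_matrixP => i; rewrite W'P row_mul.
have Vh a g : homog_of_degree (z - res_shift g) ((U *m res_diff F l) a g).
  rewrite mxE; apply: homog_of_degree_sum => k _.
  rewrite (_ : z - _ = (z - res_shift k) + (res_shift k - res_shift g)); last lia.
  by apply: homog_of_degreeM => //; apply: res_diff_homog.
have /fin_all_exists[f fP] (g : 'I_(res_rank F l)) :
    exists w : 'cV[S]_(koszul_dim (vars K N)),
      (forall a, homog_of_degree (z - res_shift g - 1) (w a 0)) /\
      col g (U *m res_diff F l) = kos *m w.
  apply: koszul_exact_homog => [i||i j].
  - by rewrite mxE.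
  - by rewrite -col_mulmx cU col0.
  - rewrite ord1 -col_mulmx mulmxA !mxE; apply: ideal_sum => [|k _].
      exact: in_seq_ideal.
    apply: idealM; first exact: in_seq_ideal.
    by apply: coef0_in_vars; apply: res_minimal.
pose U' := \matrix_(a, g) f g a 0.
have UE : U *m res_diff F l = kos *m U'.
  apply/matrixP => a g; have := proj2 (fP g) => /matrixP/(_ a 0).
  by rewrite [LHS]mxE => ->; rewrite !mxE; apply: eq_bigr => b _; rewrite mxE.
have [|||W [W' WE]] := IH (z - 1) U'.
- by move=> a g; rewrite mxE addrAC; apply: (proj1 (fP g)).
- by lia.
- exact: koszul_cycle_lift UE.
have [|W2 W2P] := @mx_exists_rows _ _ _ (res_rank F l.+2)
    (fun v w' => v = w' *m res_diff F l.+1) (U - kos *m W').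
  move=> i; apply/res_exactS.
  rewrite -row_mul mulmxBl UE WE mulmxDr !mulmxA koszul_sq mul0mx add0r subrr.
  by rewrite row0.
exists W', W2; apply/eqP; rewrite addrC -subr_eq; apply/eqP.
by apply/row_matrixP => i; rewrite W2P row_mul.
Qed.

(** A basis vector of [F_l] of too large degree, put in Koszul degree 0, splits by
[resolution_split] into a Koszul boundary and an element of the image of
[F_(l + 1)].  Both have coordinates in the maximal ideal after augmentation, but
the basis vector has a coordinate 1. *)
Lemma resolution_shift_le r l (k : 'I_(res_rank F l)) :
  koszul_reg J r -> res_shift k - l%:Z <= r%:Z.
Proof.
move=> TJ; rewrite leNgt; apply/negP => k_gt.
pose U := eps^T *m delta_mx (0 : 'I_1) k.
have [|||W [W' UE]] := @resolution_split r TJ l (res_shift k) U.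
- move=> a g; rewrite mxE big_ord1 [X in _ * X]mxE eqxx andTb.
  case: eqP => [->|_]; last by rewrite mulr0; apply: homog_of_degree0.
  rewrite mulr1 subrr mxE.
  have /homog_of_degree_nat : eps 0 a \is 0.-homog; last by [].
  elim: (vars K N) a {U} => [|y s IH] /= a.
    by rewrite ord1 mxE eqxx dhomog1.
  by rewrite mxE; case: splitP => j _; rewrite ?IH // mxE dhomog0.
- by lia.
- case: (l) (k) @U => [|l'] k' /=; rewrite !mulmxA koszul_aug_tr !mul0mx //.
  exact: mx_in0.
have : (eps *m U) 0 k = 1 by rewrite mulmxA koszul_aug_aug mul1mx mxE !eqxx.
rewrite UE mulmxDr !mulmxA mxE => /(congr1 (mcoeff 0%MM)).
rewrite mcoeff1 eqxx mcoeffD [X in X + _]in_vars_coef0; last first.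
  by apply: mx_inMr; [apply: in_seq_ideal | apply: koszul_aug_in].
rewrite add0r mxE raddf_sum big1 /= => [/esym/eqP|i _]; first by rewrite oner_eq0.
rewrite mulrC; apply: in_vars_coef0; apply: ideal_mulr; first exact: in_seq_ideal.
by apply: coef0_in_vars; apply: res_minimal.
Qed.

End Resolution.
End Link.

(** * Binomial ideals of interval graphs *)

Section AdjoinSeq.
Import mpoly.
Variables (K : fieldType) (N : nat).
Local Notation S := {mpoly K[N]}.
Implicit Types (J : S -> Prop) (p q a f : S) (z : 'I_N).

Lemma divvar_stable_adjoin z J f :
  divvar_stable z J -> varfree z f -> divvar_stable z (adjoin J f).
Proof.
move=> st ff p [a /st]; rewrite raddfB /= ff => Ja.
by exists (divvar z a).
Qed.

Definition adjoin_vars J (l : seq 'I_N) : S -> Prop :=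
  foldr (fun z J' => adjoin J' 'X_z) J l.

Lemma adjoin_vars_ideal J l : is_ideal J -> is_ideal (adjoin_vars J l).
Proof. by move=> iJ; elim: l => //= z l IH; apply: adjoin_ideal. Qed.

Lemma adjoin_vars_sub J l p : J p -> adjoin_vars J l p.
Proof. by move=> Jp; elim: l => //= z l IH; apply: adjoin_sub. Qed.

Lemma adjoin_vars_mem J l z : is_ideal J -> z \in l -> adjoin_vars J l 'X_z.
Proof.
move=> iJ; elim: l => //= y l IH; rewrite inE => /orP[/eqP->|/IH]; last exact: adjoin_sub.
by apply: adjoin_gen; apply: adjoin_vars_ideal.
Qed.

Lemma adjoin_vars_le J J' l : is_ideal J' -> (forall p, J p -> J' p) ->
  (forall z, z \in l -> J' 'X_z) -> forall p, adjoin_vars J l p -> J' p.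
Proof.
move=> iJ' JJ'; elim: l => //= z l IH lJ'; apply: adjoin_le => //.
- by apply: IH => y yl; apply: lJ'; rewrite inE yl orbT.
- by apply: lJ'; rewrite inE eqxx.
Qed.

Lemma graded_adjoin_vars J l : graded J -> graded (adjoin_vars J l).
Proof. by move=> gJ; elim: l => //= z l IH; apply: graded_adjoin (var_homog _ z). Qed.

Lemma koszul_reg_adjoin_vars J l r : is_ideal J -> graded J -> uniq l ->
  (forall z, z \in l -> divvar_stable z J) ->
  koszul_reg J r -> koszul_reg (adjoin_vars J l) r.
Proof.
move=> iJ gJ; elim: l => //= z l IH /andP[zl ul] st TJ.
apply: koszul_reg_adjoin.
- exact: adjoin_vars_ideal.
- exact: graded_adjoin_vars.
- apply: divvar_stable_nzd.
  have : divvar_stable z J by apply: st; rewrite inE eqxx.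
  elim: l zl {IH ul st TJ} => //= y l IH; rewrite inE negb_or => /andP[zy zl] st.
  apply: divvar_stable_adjoin; first exact: IH.
  by apply: varfreeX; rewrite eq_sym.
- by apply: IH => // y yl; apply: st; rewrite inE yl orbT.
Qed.
End AdjoinSeq.

Section IntervalGraph.
Import mpoly.
Variables (K : fieldType) (N n : nat).
Local Notation S := {mpoly K[N]}.
Variables (vx vy : nat -> 'I_N) (E : rel nat).
Hypothesis vx_neq : forall i j, (i < n)%N -> (j < n)%N -> i != j -> vx i != vx j.
Hypothesis vy_neq : forall i j, (i < n)%N -> (j < n)%N -> i != j -> vy i != vy j.
Hypothesis vxy_neq : forall i j, (i < n)%N -> (j < n)%N -> vx i != vy j.
Hypothesis E_interval : forall i k j, (i < k)%N -> (k < j)%N -> (j < n)%N ->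
  E i j -> E i k /\ E k j.

Definition xv i : S := 'X_(vx i).
Definition yv i : S := 'X_(vy i).
Definition binom i j : S := xv i * yv j - xv j * yv i.

Definition binom_gen m (g : S) : Prop :=
  exists i j, [/\ (i < j)%N, (j < m)%N, E i j & g = binom i j].

(** The ideals met on the way from the edge ideal to the zero ideal: the graph on
the vertices below [m], and monomials from the edges that join such a vertex to
one in [[s, p[]. *)
Definition mixed_gen m s p (g : S) : Prop :=
  binom_gen m g \/
  exists i j, [/\ (i < m)%N, (s <= j < p)%N, E i j & g = xv i * yv j].

Definition binom_ideal m := ideal_gen (binom_gen m).
Definition mixed_ideal m s p := ideal_gen (mixed_gen m s p).

Lemma binom_homog i j : binom i j \is 2.-homog.
Proof. by apply: rpredB; apply: (dhomogM (d := 1) (e := 1)); apply: var_homog. Qed.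

Lemma mixed_graded m s p : graded (mixed_ideal m s p).
Proof.
apply: graded_ideal_gen => g [[i [j [_ _ _ ->]]]|[i [j [_ _ _ ->]]]]; exists 2%N.
  exact: binom_homog.
by apply: (dhomogM (d := 1) (e := 1)); apply: var_homog.
Qed.

Lemma binom_free z i j : vx i != z -> vy i != z -> vx j != z -> vy j != z ->
  varfree z (binom i j).
Proof.
move=> xi yi xj yj.
by apply: varfreeD; last apply: varfreeN; apply: varfreeM; apply: varfreeX.
Qed.

Lemma binom_gen_free_x m k g : (m <= k)%N -> (k < n)%N -> binom_gen m g ->
  varfree (vx k) g.
Proof.
move=> mk kn [i [j [ij jm _ ->]]].
by apply: binom_free; rewrite 1?[vy _ == _]eq_sym; (apply: vx_neq || apply: vxy_neq); lia.
Qed.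

Lemma binom_gen_free_y m k g : (m <= k)%N -> (k < n)%N -> binom_gen m g ->
  varfree (vy k) g.
Proof.
move=> mk kn [i [j [ij jm _ ->]]].
by apply: binom_free; (apply: vy_neq || apply: vxy_neq); lia.
Qed.

Lemma binom_ideal_succ m p : binom_ideal m.+1 p ->
  exists q (h : 'I_m -> S), binom_ideal m q /\
    p = q + \sum_(i < m | E i m) h i * binom i m.
Proof.
pose P p := exists q (h : 'I_m -> S), binom_ideal m q /\
    p = q + \sum_(i < m | E i m) h i * binom i m.
apply: (@ideal_gen_le _ _ P).
  split.
  - exists 0, (fun=> 0); split; first exact: ideal_gen0.
    by rewrite big1 ?addr0 // => i _; rewrite mul0r.
  - move=> _ _ [q1 [h1 [J1 ->]]] [q2 [h2 [J2 ->]]].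
    exists (q1 + q2), (fun i => h1 i + h2 i); split.
      by apply: idealD => //; apply: ideal_gen_ideal.
    rewrite addrACA -big_split; congr (_ + _).
    by apply: eq_bigr => i _; rewrite mulrDl.
  - move=> a _ [q [h [Jq ->]]]; exists (a * q), (fun i => a * h i); split.
      by apply: idealM => //; apply: ideal_gen_ideal.
    rewrite mulrDr mulr_sumr; congr (_ + _).
    by apply: eq_bigr => i _; rewrite mulrA.
move=> g [i [j [ij jm Eij ->]]].
have [j_lt|m_le] := ltnP j m.
  exists (binom i j), (fun=> 0); split; first by apply: ideal_gen_mem; exists i, j.
  by rewrite big1 ?addr0 // => k _; rewrite mul0r.
have jE : j = m by apply/eqP; rewrite eqn_leq m_le -ltnS jm.
rewrite {}jE {jm m_le} in ij Eij *.
exists 0, (fun k => (k == Ordinal ij)%:R); split; first exact: ideal_gen0.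
rewrite add0r (bigD1 (Ordinal ij)) //= eqxx mul1r big1 ?addr0 // => k /andP[_ /negPf ->].
by rewrite mul0r.
Qed.

(** The syzygies of the [x_i], for [i] in a clique with greatest element [m - 1],
modulo the edge ideal are syzygies of the [y_i]: since
[x_i * y_(m - 1) = x_(m - 1) * y_i] modulo the ideal, this holds after
multiplication by the regular element [x_(m - 1)]. *)
Lemma binom_transfer m (h : 'I_m -> S) :
  (m < n)%N -> (forall k, m = k.+1 -> nonzerodivisor (binom_ideal m) (xv k)) ->
  binom_ideal m (\sum_(i < m | E i m) h i * xv i) ->
  binom_ideal m (\sum_(i < m | E i m) h i * yv i).
Proof.
case: m h => [|m] h mn xreg JA; first by rewrite big_ord0; apply: ideal_gen0.
have iJ := ideal_gen_ideal (binom_gen m.+1).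
apply: (xreg m erefl).
have -> : (\sum_(i < m.+1 | E i m.+1) h i * yv i) * xv m =
    (\sum_(i < m.+1 | E i m.+1) h i * xv i) * yv m
      - \sum_(i < m.+1 | E i m.+1) h i * binom i m.
  rewrite !mulr_suml -sumrB; apply: eq_bigr => i _; rewrite /binom; ring.
apply: idealB => //; first exact: ideal_mulr.
apply: ideal_sum => // i Ei; apply: idealM => //.
have [im|] := eqVneq (i : nat) m; first by rewrite /binom im subrr; apply: ideal0.
move=> ne_im; have i_lt : (i < m)%N by have := ltn_ord i; lia.
have [Eim _] := E_interval i_lt (ltnSn m) mn Ei.
by apply: ideal_gen_mem; exists i, m.
Qed.

(** If [p * x_m] is in the ideal, setting [x_m = 0] yields a relation
[y_m * (\sum h_i * x_i) = 0] modulo the ideal of the earlier vertices; dividing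
by [x_m] then expresses [p] through the generators and [\sum h_i * y_i], which is
in the ideal by [binom_transfer]. *)
Lemma xv_nzd m : (m < n)%N -> nonzerodivisor (binom_ideal m.+1) (xv m).
Proof.
elim/ltn_ind: m => m IH mn p /binom_ideal_succ[q [h [Jq pE]]].
have iJ := ideal_gen_ideal (binom_gen m).
have iJ1 := ideal_gen_ideal (binom_gen m.+1).
have J_J1 g : binom_ideal m g -> binom_ideal m.+1 g.
  apply: ideal_gen_le => // {}g [i [j [ij jm Eij ->]]].
  by apply: ideal_gen_mem; exists i, j; split=> //; lia.
have stx : divvar_stable (vx m) (binom_ideal m).
  by apply: divvar_stable_gen => g; apply: binom_gen_free_x.
have sty : divvar_stable (vy m) (binom_ideal m).
  by apply: divvar_stable_gen => g; apply: binom_gen_free_y.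
have xi_free (i : 'I_m) : varfree (vx m) (xv i).
  by apply: varfreeX; apply: vx_neq; have := ltn_ord i; lia.
have yi_free (i : nat) : (i < n)%N -> varfree (vx m) (yv i).
  by move=> i_lt; apply: varfreeX; rewrite eq_sym; apply: vxy_neq.
have yi_free' (i : 'I_m) : varfree (vx m) (yv i).
  by apply: yi_free; have := ltn_ord i; lia.
pose h0 i := setvar0 (vx m) (h i).
have JA : binom_ideal m (\sum_(i < m | E i m) h0 i * xv i).
  apply: (divvar_stable_nzd sty).
  have -> : (\sum_(i < m | E i m) h0 i * xv i) * 'X_(vy m) = - setvar0 (vx m) q.
    apply/eqP; rewrite -addr_eq0 addrC; apply/eqP.
    have := congr1 (setvar0 (vx m)) pE; rewrite setvar0MX raddfD /= raddf_sum /= => {2}->.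
    congr (_ + _); rewrite mulr_suml; apply: eq_bigr => i _.
    rewrite /binom (_ : h i * _ = h i * (xv i * yv m) - h i * yv i * 'X_(vx m)); last first.
      by rewrite /xv /yv; ring.
    rewrite raddfB /= setvar0MX subr0 setvar0M ?mulrA //.
    by apply: varfreeM => //; apply: yi_free.
  by apply: idealN => //; apply: setvar0_stable.
have JB : binom_ideal m (\sum_(i < m | E i m) h0 i * yv i).
  apply: binom_transfer => // k mk; rewrite mk; apply: IH; lia.
have -> : p = divvar (vx m) q + \sum_(i < m | E i m) divvar (vx m) (h i) * binom i m
              - \sum_(i < m | E i m) h0 i * yv i.
  rewrite -(divvarMX (vx m) p) -/(xv m) pE raddfD /= raddf_sum /= -addrA -sumrB.
  congr (_ + _); apply: eq_bigr => i _.
  rewrite /binom (_ : h i * _ = h i * (xv i * yv m) - h i * yv i * 'X_(vx m)); last first.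
    by rewrite /xv /yv; ring.
  rewrite raddfB /= divvarMX (varfreeM (xi_free i) (yi_free m mn)) /h0 /setvar0.
  by rewrite /xv /yv; ring.
apply: idealB => //; last exact: J_J1.
apply: idealD => //; first exact/J_J1/stx.
apply: ideal_sum => // i Eim; apply: idealM => //.
by apply: ideal_gen_mem; exists i, m.
Qed.

Lemma mixed_sub_binom m s p f : binom_ideal m f -> mixed_ideal m s p f.
Proof.
apply: ideal_gen_le; first exact: ideal_gen_ideal.
by move=> g Gg; apply: ideal_gen_mem; left.
Qed.

Lemma mixed_mono m s p i j : (i < m)%N -> (s <= j < p)%N -> E i j ->
  mixed_ideal m s p (xv i * yv j).
Proof. by move=> *; apply: ideal_gen_mem; right; exists i, j. Qed.

Lemma mixed_stable_x m s p k : (m <= k)%N -> (k < n)%N -> (p <= n)%N ->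
  divvar_stable (vx k) (mixed_ideal m s p).
Proof.
move=> mk kn pn; apply: divvar_stable_gen => g [|[i [j [im /andP[sj jp] _ ->]]]].
  exact: binom_gen_free_x.
apply: varfreeM; apply: varfreeX; first by apply: vx_neq; lia.
by rewrite eq_sym; apply: vxy_neq; lia.
Qed.

(** Modulo the regular element [x_m] the binomial of an edge [i < m] becomes the
monomial [x_i * y_m]. *)
Lemma koszul_reg_binom_succ m r : (m < n)%N ->
  koszul_reg (mixed_ideal m m m.+1) r -> koszul_reg (binom_ideal m.+1) r.
Proof.
move=> mn TI.
have iI := ideal_gen_ideal (mixed_gen m m m.+1).
have iJ := ideal_gen_ideal (binom_gen m.+1).
apply: (koszul_reg_divide (z := vx m)) => //; first exact: xv_nzd.
apply: (koszul_reg_ext (J := adjoin (mixed_ideal m m m.+1) 'X_(vx m))); last first.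
  apply: koszul_reg_adjoin => //; first exact: mixed_graded.
  by apply: divvar_stable_nzd; apply: mixed_stable_x.
move=> p; split; apply: adjoin_le; try exact: adjoin_ideal; try exact: adjoin_gen.
  apply: ideal_gen_le; first exact: adjoin_ideal.
  move=> g [[i [j [ij jm Eij ->]]]|[i [j [im mj Eij ->]]]].
    by apply/adjoin_sub/ideal_gen_mem; exists i, j; split=> //; lia.
  have jE : j = m by lia.
  rewrite {}jE in Eij *.
  exists (yv i); rewrite -/(xv m) (_ : _ - _ = binom i m); last by rewrite /binom; ring.
  by apply: ideal_gen_mem; exists i, m.
apply: ideal_gen_le; first exact: adjoin_ideal.
move=> g [i [j [ij jm Eij ->]]].
have [j_lt|m_le] := ltnP j m.
  by apply/adjoin_sub/ideal_gen_mem; left; exists i, j; split=> //; lia.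
have jE : j = m by lia.
rewrite {}jE in ij Eij *.
exists (- yv i); rewrite -/(xv m) (_ : _ - _ = xv i * yv m); last by rewrite /binom; ring.
by apply: mixed_mono => //; lia.
Qed.

(** Adding [y_s] removes its monomials.  The colon by [y_s] contains the variables
[x_i] with [c <= i < m]; modulo these, the monomials of later [y_j] vanish and
the binomials of edges [i < c <= j] become [x_i * y_j], which leaves a mixed ideal
on the vertices below [c]. *)
Lemma koszul_reg_mixed_step m s p c r : (m <= s)%N -> (s < p)%N -> (p <= n)%N ->
  (c < m)%N -> (forall i, (i < m)%N -> E i s = (c <= i)%N) ->
  koszul_reg (mixed_ideal c c m) r -> koszul_reg (mixed_ideal m s.+1 p) r.+1 ->
  koszul_reg (mixed_ideal m s p) r.+1.
Proof.
move=> ms sp pn cm cE TC TA.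
have iI m' s' p' : is_ideal (mixed_ideal m' s' p') by apply: ideal_gen_ideal.
have Es i j : (i < m)%N -> (s <= j < p)%N -> E i j -> (c <= i)%N.
  move=> im /andP[sj jp] Eij; rewrite -cE //.
  have [-> //|ne_sj] := eqVneq s j.
  by have [] := @E_interval i s j; lia.
pose L := adjoin_vars (mixed_ideal c c m) [seq vx i | i <- iota c (m - c)].
have iL : is_ideal L by apply: adjoin_vars_ideal.
have Lx i : (c <= i < m)%N -> L (xv i).
  by move=> ci; apply: adjoin_vars_mem => //; apply: map_f; rewrite mem_iota; lia.
apply: (koszul_reg_colon (z := vy s)) => //.
- exact: mixed_graded.
- apply: (koszul_reg_ext (J := adjoin (mixed_ideal m s.+1 p) 'X_(vy s))); last first.
    apply: koszul_reg_adjoin => //; first exact: mixed_graded.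
    apply: divvar_stable_nzd; apply: divvar_stable_gen => g.
    move=> [|[i [j [im /andP[sj jp] _ ->]]]]; first by apply: binom_gen_free_y; lia.
    by apply: varfreeM; apply: varfreeX; [apply: vxy_neq | apply: vy_neq]; lia.
  move=> f; split; apply: adjoin_le; try exact: adjoin_ideal; try exact: adjoin_gen.
    apply: ideal_gen_le; first exact: adjoin_ideal.
    move=> g [Gg|[i [j [im sj Eij ->]]]]; apply/adjoin_sub.
      by apply: ideal_gen_mem; left.
    by apply: mixed_mono => //; lia.
  apply: ideal_gen_le; first exact: adjoin_ideal.
  move=> g [Gg|[i [j [im sj Eij ->]]]].
    by apply/adjoin_sub/ideal_gen_mem; left.
  have [<-|ne_sj] := eqVneq s j.
    by apply: idealM; [apply: adjoin_ideal | apply: adjoin_gen].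
  by apply/adjoin_sub/mixed_mono => //; lia.
apply: (koszul_reg_ext (J := L)); last first.
  apply: koszul_reg_adjoin_vars => //.
  - exact: mixed_graded.
  - rewrite map_inj_in_uniq ?iota_uniq // => i j; rewrite !mem_iota => ci cj.
    by apply: contra_eq => ne_ij; apply: vx_neq => //; lia.
  - move=> z /mapP[i]; rewrite mem_iota => ci ->.
    by apply: mixed_stable_x; lia.
move=> f; split.
  move: f; apply: adjoin_vars_le; first exact: colon_ideal.
  - apply: ideal_gen_le; first exact: colon_ideal.
    move=> g [[i [j [ij jc Eij ->]]]|[i [j [ic cj Eij ->]]]].
      apply: ideal_mulr => //; apply: ideal_gen_mem; left; exists i, j.
      by split=> //; lia.
    rewrite /colon -/(yv s).
    rewrite (_ : _ * yv s = yv s * binom i j + yv i * (xv j * yv s)); last first.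
      by rewrite /binom; ring.
    apply: idealD => //; apply: idealM => //.
      by apply: ideal_gen_mem; left; exists i, j; split=> //; lia.
    by apply: mixed_mono; rewrite ?cE; lia.
  - move=> z /mapP[i]; rewrite mem_iota => ci ->.
    by apply: mixed_mono; rewrite ?cE; lia.
suff Ldiv g : mixed_ideal m s p g -> L (divvar (vy s) g).
  by move=> /Ldiv; rewrite divvarMX.
elim=> [|a {}g q Gg _ IH]; first by rewrite raddf0; apply: ideal0.
rewrite raddfD /=; apply: idealD => //; case: Gg => [Gg|].
  rewrite (binom_gen_free_y _ _ Gg); try lia.
  apply: idealM => //; case: Gg => i [j [ij jm Eij ->]].
  have [j_lt|c_le] := ltnP j c.
    by apply/adjoin_vars_sub/ideal_gen_mem; left; exists i, j.
  have Lj : L (xv j) by apply: Lx; lia.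
  apply: idealB => //; last exact: ideal_mulr.
  have [i_lt|c_le_i] := ltnP i c; last by apply: ideal_mulr => //; apply: Lx; lia.
  by apply/adjoin_vars_sub/mixed_mono => //; lia.
move=> [i [j [im sj Eij ->]]].
have Li : L (xv i) by apply: Lx; rewrite im andbT; apply: Es Eij.
have [<-|ne_sj] := eqVneq s j.
  by rewrite mulrA divvarMX; apply: idealM.
rewrite (_ : divvar _ _ = divvar (vy s) a * (xv i * yv j)).
  by apply: idealM => //; apply: ideal_mulr.
by apply: varfreeM; apply: varfreeX; [apply: vxy_neq | apply: vy_neq]; lia.
Qed.

(** [v] is the least neighbour of some later vertex. *)
Definition lowest v : bool := [exists j : 'I_n, [&& (v < j)%N, E v j &
  [forall i : 'I_n, (i < j)%N && E i j ==> (v <= i)%N]]].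

Definition num_lowest m : nat := count lowest (iota 0 m).

Lemma lowestP v : reflect (exists j, [/\ (v < j < n)%N, E v j &
  forall i, (i < j)%N -> E i j -> (v <= i)%N]) (lowest v).
Proof.
apply: (iffP existsP) => [[j /and3P[vj Evj /forallP jP]]|[j [/andP[vj jn] Evj jP]]].
  exists j; split=> // [|i ij Eij]; first by rewrite vj ltn_ord.
  have i_lt : (i < n)%N by apply: ltn_trans ij (ltn_ord j).
  by have := jP (Ordinal i_lt); rewrite /= ij Eij.
exists (Ordinal jn); rewrite vj Evj /=; apply/forallP => i; apply/implyP => /andP[].
exact: jP.
Qed.

Lemma num_lowest_le m m' : (m <= m')%N -> (num_lowest m <= num_lowest m')%N.
Proof. by move=> mm'; rewrite /num_lowest -(subnKC mm') iotaD count_cat leq_addr. Qed.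

Lemma num_lowest_lt c m : lowest c -> (c < m)%N -> (num_lowest c < num_lowest m)%N.
Proof.
move=> lc cm; apply: leq_trans (num_lowest_le cm).
by rewrite /num_lowest -[in X in (_ < X)%N]addn1 iotaD count_cat /= add0n lc addn0 addn1.
Qed.

(** In a colon step [c] is the least neighbour of [s], so passing from [m] to [c]
loses at least one lowest vertex, which pays for the loss of one in the bound. *)
Lemma koszul_reg_mixed m s p : (m <= s)%N -> (m <= n)%N -> (p <= n)%N ->
  koszul_reg (mixed_ideal m s p) (num_lowest m).
Proof.
elim/ltn_ind: m s p => m IHm s p ms mn pn.
have [k] := ubnP (p - s); elim: k s ms => // k IHk s ms ks.
have [s_lt|p_le] := ltnP s p; last first.
  apply: (koszul_reg_ext (J := binom_ideal m)) => [f|].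
    split; first exact: mixed_sub_binom.
    apply: ideal_gen_le; first exact: ideal_gen_ideal.
    move=> g [Gg|[i [j [_ sj _ _]]]]; last lia.
    exact: ideal_gen_mem.
  case: (m) mn IHm => [|m'] mn IHm; last first.
    apply: koszul_reg_binom_succ => //; apply: koszul_reg_le (num_lowest_le (leqnSn m')) _.
    by apply: IHm => //; lia.
  apply: koszul_reg_zero => f; split=> [|->]; last exact: ideal_gen0.
  by elim=> // a g q [i [j [_ ]]].
have [/existsP[c0 Ec0]|noE] := boolP [exists i : 'I_m, E i s]; last first.
  apply: (koszul_reg_ext (J := mixed_ideal m s.+1 p)); last by apply: IHk; lia.
  move=> f; split; apply: ideal_gen_le; try exact: ideal_gen_ideal.
    move=> g [Gg|[i [j [im sj Eij ->]]]]; first by apply: ideal_gen_mem; left.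
    by apply: mixed_mono => //; lia.
  move=> g [Gg|[i [j [im sj Eij ->]]]]; first by apply: ideal_gen_mem; left.
  apply: mixed_mono => //; suff : s != j by lia.
  apply: contraNneq noE => sE; apply/existsP; exists (Ordinal im).
  by rewrite /= sE.
have exc : exists i, E i s by exists c0.
case: (ex_minnP exc) => c Ecs cmin.
have cm : (c < m)%N by apply: leq_ltn_trans (ltn_ord c0); apply: cmin.
have lc : (num_lowest c < num_lowest m)%N.
  apply: num_lowest_lt => //; apply/lowestP; exists s; split=> //; first lia.
  by move=> i _; apply: cmin.
have -> : num_lowest m = (num_lowest m).-1.+1 by rewrite prednK //; lia.
apply: (koszul_reg_mixed_step (c := c)) => //.
- move=> i im; apply/idP/idP; first exact: cmin.
  rewrite leq_eqVlt => /orP[/eqP<- //|ci].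
  by have [] := @E_interval c i s; lia.
- apply: (koszul_reg_le (r := num_lowest c)); first lia.
  by apply: IHm; lia.
- rewrite prednK; last lia.
  by apply: IHk; lia.
Qed.

Lemma koszul_reg_binom : (0 < n)%N -> koszul_reg (binom_ideal n) (num_lowest n.-1).
Proof.
move=> n_gt0; rewrite -[X in binom_ideal X](prednK n_gt0).
by apply: koszul_reg_binom_succ; [lia | apply: koszul_reg_mixed; lia].
Qed.

(** By descending induction on [v], the least neighbour of [v + 1] is [v]: some
[j > v] has least neighbour [v], and if [j > v + 1] the induction gives [j - 1] as
its least neighbour instead. *)
Lemma num_lowest_path : (n.-1 <= num_lowest n.-1)%N ->
  forall i j, (i < j)%N -> (j < n)%N -> E i j = (j == i.+1).
Proof.
move=> low_all.
have all_lowest v : (v < n.-1)%N -> lowest v.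
  move: low_all; rewrite /num_lowest -[X in (X <= _)%N](size_iota 0).
  rewrite leq_eqVlt ltnNge count_size orbF eq_sym -all_count => /allP lP vn.
  by apply: lP; rewrite mem_iota.
have path_at v : (v.+1 < n)%N -> E v v.+1 /\ forall i, (i < v.+1)%N -> E i v.+1 -> (v <= i)%N.
  have [k] := ubnP (n - v); elim: k v => // k IH v kv vn.
  have /lowestP[j [/andP[vj jn] Evj jmin]] : lowest v by apply: all_lowest; lia.
  have [jE|ne_j] := eqVneq j v.+1; first by rewrite jE in Evj jmin.
  have [||_] := IH j.-1; rewrite ?prednK; try lia.
  by move=> /(_ v vj Evj); lia.
move=> i j ij jn; apply/idP/eqP => [Eij|->]; last by apply: (path_at i _).1; lia.
by have := (path_at j.-1 _).2 i; rewrite prednK; lia.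
Qed.

End IntervalGraph.

(** * Mapping cones and paths *)

Section Cone.
Import mpoly.
Variables (K : fieldType) (N : nat).
Local Notation S := {mpoly K[N]}.
Variables (J : S -> Prop) (iJ : is_ideal J) (F : min_graded_resolution J).
Variables (f : S) (f_homog : f \is 2.-homog) (f_nzd : nonzerodivisor J f).
Variables (J' : S -> Prop) (J'E : forall p, J' p <-> adjoin J f p).
Local Notation rk := (res_rank F).

(** Rank of [F_(i - 1)], with [F_(-1) = 0].  The cone has [F_i + F_(i - 1)(- 2)] in
degree [i]. *)
Definition prev_rank i : nat := if i is i'.+1 then rk i' else 0.

Definition prev_shift i : 'I_(prev_rank i) -> int :=
  if i is i'.+1 then fun k : 'I_(rk i') => res_shift k + 2 else fun=> 0.

Definition prev_diff i : 'M[S]_(rk i, prev_rank i) :=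
  if i is i'.+1 then res_diff F i' else 0.

Definition cone_shift i (k : 'I_(rk i + prev_rank i)) : int :=
  match split k with inl k' => res_shift k' | inr k' => prev_shift k' end.

Definition cone_diff i : 'M[S]_(rk i.+1 + prev_rank i.+1, rk i + prev_rank i) :=
  block_mx (res_diff F i) 0 (f%:M : 'M_(rk i)) (- prev_diff i).

Definition cone_aug : 'cV[S]_(rk 0 + prev_rank 0) := col_mx (res_aug F) 0.

Lemma cone_aug_homog k : homog_of_degree (cone_shift k) (cone_aug k 0).
Proof.
rewrite /cone_shift /cone_aug mxE; case: splitP => k' _; first exact: res_aug_homog.
by rewrite mxE; apply: homog_of_degree0.
Qed.

Lemma cone_diff_homog i k l :
  homog_of_degree (cone_shift k - cone_shift l) (cone_diff i k l).
Proof.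
rewrite /cone_shift /cone_diff mxE; case: splitP => k' _; rewrite mxE; case: splitP => l' _.
- exact: res_diff_homog.
- by rewrite mxE; apply: homog_of_degree0.
- rewrite mxE /=; case: eqP => [->|_]; last exact: homog_of_degree0.
  by rewrite mulr1n addrC addKr; apply/homog_of_degree_nat.
- rewrite mxE; apply: homog_of_degreeN; case: (i) k' l' => [|i'] k' l'; first by case: l'.
  by rewrite /= opprD addrACA subrr addr0; apply: res_diff_homog.
Qed.

Lemma cone_minimal i k l : (cone_diff i k l)@_0%MM = 0.
Proof.
rewrite /cone_diff mxE; case: splitP => k' _; rewrite mxE; case: splitP => l' _.
- exact: res_minimal.
- by rewrite mxE mcoeff0.
- rewrite mxE; case: eqP => _; rewrite ?mulr0n ?mcoeff0 // mulr1n.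
  by apply: (dhomog_nemf_coeff f_homog); rewrite /= mdeg0.
- rewrite mxE mcoeffN; case: (i) k' l' => [|i'] k' l'; first by case: l'.
  by rewrite /= res_minimal oppr0.
Qed.

Lemma mul_cone_diff i (a : 'rV_(rk i.+1)) (b : 'rV_(rk i)) :
  row_mx a b *m cone_diff i = row_mx (a *m res_diff F i + f *: b) (- (b *m prev_diff i)).
Proof. by rewrite mul_row_block mulmx0 add0r mulmxN mul_mx_scalar. Qed.

Lemma prev_diff_sq i : prev_diff i.+1 *m prev_diff i = 0.
Proof. by case: i => [|i]; [rewrite mulmx0 | apply: diff_diff]. Qed.

Lemma cone_aug_surj p : exists v : 'rV_(rk 0 + prev_rank 0), J' (p - (v *m cone_aug) 0 0).
Proof.
have [v Jv] := res_aug_surj F p; exists (row_mx v 0).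
by rewrite mul_row_col mul0mx addr0; apply/J'E/adjoin_sub.
Qed.

Lemma cone_exact0 (v : 'rV_(rk 0 + prev_rank 0)) :
  J' ((v *m cone_aug) 0 0) <-> exists w, v = w *m cone_diff 0.
Proof.
rewrite -[v]hsubmxK; move: (lsubmx v) (rsubmx v) => a b.
have -> : b = 0 by apply/matrixP => ? [].
rewrite mul_row_col mul0mx addr0; split.
  move=> /J'E[c Jc]; have [w Jw] := res_aug_surj F c.
  have /res_exact0[w1 w1E] : J (((a - f *: w) *m res_aug F) 0 0).
    rewrite mulmxBl -scalemxAl !mxE in Jc Jw *.
    set A := \sum_j _ in Jc *; set B := \sum_j _ in Jw *.
    rewrite (_ : A - f * B = (A - c * f) + f * (c - B)); last by ring.
    by apply: idealD => //; apply: idealM.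
  exists (row_mx w1 w); rewrite mul_cone_diff -w1E subrK.
  by congr row_mx; apply/matrixP => ? [].
case=> w; rewrite -[w]hsubmxK mul_cone_diff => /eq_row_mx[-> _].
apply/J'E; exists ((rsubmx w *m res_aug F) 0 0).
rewrite mulmxDl -scalemxAl -mulmxA mxE [X in _ + X - _]mxE mulrC addrK.
by apply: mx_inMl => //; apply: diff_aug.
Qed.

Lemma cone_exactS i (v : 'rV_(rk i.+1 + prev_rank i.+1)) :
  v *m cone_diff i = 0 <-> exists w, v = w *m cone_diff i.+1.
Proof.
rewrite -[v]hsubmxK; move: (lsubmx v) (rsubmx v) => a b; split; last first.
  case=> w; rewrite -[w]hsubmxK mul_cone_diff => /eq_row_mx[-> ->].
  rewrite mul_cone_diff mulmxDl -mulmxA diff_diff mulmx0 add0r -scalemxAl scalerN.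
  by rewrite subrr mulNmx opprK -mulmxA prev_diff_sq mulmx0 row_mx0.
rewrite mul_cone_diff -[0 in X in X -> _]row_mx0 => /eq_row_mx[abE /eqP].
rewrite oppr_eq0 => /eqP b0.
have [w wE] : exists w, b = w *m res_diff F i.
  move: a b abE b0 {v}; case: (i) => [|i'] a b abE b0; last exact/res_exactS.
  apply/res_exact0; apply: f_nzd.
  have -> : (b *m res_aug F) 0 0 * f = - (a *m (res_diff F 0 *m res_aug F)) 0 0.
    apply/eqP; rewrite -addr_eq0 mulmxA addrC.
    have := congr1 (fun M : 'rV_(rk 0) => (M *m res_aug F) 0 0) abE.
    by rewrite /= mulmxDl -scalemxAl mul0mx mxE [X in _ + X]mxE mulrC [RHS]mxE => ->.
  by apply: idealN => //; apply: mx_inMl => //; apply: diff_aug.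
have /res_exactS[w1 w1E] : (a + f *: w) *m res_diff F i = 0.
  by rewrite mulmxDl -scalemxAl -wE.
exists (row_mx w1 (- w)); rewrite mul_cone_diff -w1E scalerN addrK.
by rewrite mulNmx opprK wE.
Qed.

Definition cone_resolution : min_graded_resolution J' :=
  @MinGradedResolution K N J' (fun i => rk i + prev_rank i)%N cone_shift
    cone_diff cone_aug cone_aug_homog cone_diff_homog cone_aug_surj
    cone_exact0 cone_exactS cone_minimal.
End Cone.

Section HasRegularity.
Import mpoly.

Lemma has_regularity_adjoin (K : fieldType) N (J J' : {mpoly K[N]} -> Prop) f r :
  is_ideal J -> f \is 2.-homog -> nonzerodivisor J f ->
  (forall p, J' p <-> adjoin J f p) ->
  has_regularity J r -> has_regularity J' (r + 1).
Proof.
move=> iJ fh freg J'E [F [F_le [i [k kE]]]].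
exists (cone_resolution iJ F fh freg J'E); split=> /=.
  move=> l m; rewrite /cone_shift; case: splitP => m' _.
    by have := F_le l m'; lia.
  by case: l m m' => [|l] m m' /=; [case: m' | have := F_le l m'; lia].
exists i.+1, (rshift _ k).
rewrite /cone_shift; have -> : split (rshift (res_rank F i.+1) k) = inr k.
  exact: (unsplitK (inr k)).
by rewrite /=; lia.
Qed.

Lemma has_regularity_ext (K : fieldType) N (J J' : {mpoly K[N]} -> Prop) r :
  (forall p, J p <-> J' p) -> has_regularity J r -> has_regularity J' r.
Proof.
move=> JJ' [[rk sh D a ah Dh asurj e0 eS Dm] /= bounds].
have asurj' p : exists v : 'rV_(rk 0%N), J' (p - (v *m a) 0 0).
  by have [v Jv] := asurj p; exists v; apply/JJ'.
have e0' (v : 'rV_(rk 0%N)) : J' ((v *m a) 0 0) <-> exists w, v = w *m D 0%N.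
  by split=> [/JJ'/e0|/e0/JJ'].
by exists (MinGradedResolution ah Dh asurj' e0' eS Dm).
Qed.

End HasRegularity.

Section TrivialResolution.
Import mpoly.
Variables (K : fieldType) (N : nat).
Local Notation S := {mpoly K[N]}.
Variables (J : S -> Prop) (J0 : forall p, J p <-> p = 0).

Definition trivial_rank i : nat := if i is 0 then 1 else 0.

Lemma has_regularity_zero : has_regularity J 0.
Proof.
have iJ : is_ideal J.
  split; first exact/J0.
    by move=> p q /J0-> /J0->; apply/J0; rewrite addr0.
  by move=> a p /J0->; apply/J0; rewrite mulr0.
unshelve eexists (@MinGradedResolution K N J trivial_rank
  (fun _ _ => 0) (fun i => 0) 1%:M _ _ _ _ _ _).
- by move=> k; rewrite !ord1 mxE; apply/homog_of_degree_nat; apply: dhomog1.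
- by move=> i [].
- by move=> p; exists p%:M; apply/J0; rewrite mulmx1 mxE subrr.
- move=> v; rewrite mulmx1; split=> [/J0 v0|[w ->]]; last first.
    by rewrite mulmx0; apply/J0; rewrite mxE.
  by exists 0; rewrite mul0mx; apply/matrixP => i j; rewrite !ord1 mxE.
- move=> i v; split=> [_|_]; first by exists 0; apply/matrixP => ? [].
  by rewrite mulmx0.
- by move=> i [].
split=> /= [|]; last by exists 0%N, 0.
by case=> [|i] [].
Qed.
End TrivialResolution.

Section PathRegularity.
Import mpoly.
Variables (K : fieldType) (N n : nat).
Local Notation S := {mpoly K[N]}.
Variables (vx vy : nat -> 'I_N) (E : rel nat).
Hypothesis vx_neq : forall i j, (i < n)%N -> (j < n)%N -> i != j -> vx i != vx j.
Hypothesis vy_neq : forall i j, (i < n)%N -> (j < n)%N -> i != j -> vy i != vy j.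
Hypothesis vxy_neq : forall i j, (i < n)%N -> (j < n)%N -> vx i != vy j.
Hypothesis E_path : forall i j, (i < j)%N -> (j < n)%N -> E i j = (j == i.+1).

Local Notation xv := (xv K vx).
Local Notation yv := (yv K vy).
Local Notation binom := (binom K vx vy).
Local Notation binom_ideal := (binom_ideal (K:=K) vx vy E).

Lemma path_interval i k j : (i < k)%N -> (k < j)%N -> (j < n)%N ->
  E i j -> E i k /\ E k j.
Proof. by move=> ik kj jn; rewrite E_path; lia. Qed.

(** Modulo [x_(m + 1)] the quadric becomes [x_m * y_(m + 1)], a product of two
regular elements.  So a multiplier [p] with [p * (x_m y_(m + 1) - x_(m + 1) y_m)]
in the ideal is in the ideal up to a multiple of [x_(m + 1)], and the cofactor has
smaller degree. *)
Lemma binom_nzd m : (m.+1 < n)%N -> nonzerodivisor (binom_ideal m.+1) (binom m m.+1).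
Proof.
move=> mn p; have iJ := ideal_gen_ideal (binom_gen (K:=K) vx vy E m.+1).
have stx : divvar_stable (vx m.+1) (binom_ideal m.+1).
  by apply: divvar_stable_gen => g; apply: (binom_gen_free_x vx_neq vxy_neq).
have sty : divvar_stable (vy m.+1) (binom_ideal m.+1).
  by apply: divvar_stable_gen => g; apply: (binom_gen_free_y vy_neq vxy_neq).
have [k] := ubnP (msize p); elim: k p => // k IH p pk Jp.
have [->|p0] := eqVneq p 0; first exact: ideal0.
have s0E : setvar0 (vx m.+1) (p * binom m m.+1) =
    setvar0 (vx m.+1) p * xv m * yv m.+1.
  rewrite (_ : p * _ = p * (xv m * yv m.+1) - p * yv m * 'X_(vx m.+1)); last first.
    by rewrite /binom /xv /yv; ring.
  rewrite raddfB /= setvar0MX subr0 setvar0M ?mulrA //.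
  apply: varfreeM; apply: varfreeX; first by apply: vx_neq; lia.
  by rewrite eq_sym; apply: vxy_neq.
have Js0 : binom_ideal m.+1 (setvar0 (vx m.+1) (p * binom m m.+1)).
  exact: setvar0_stable.
have Jp0 : binom_ideal m.+1 (setvar0 (vx m.+1) p).
  apply: (xv_nzd vx_neq vy_neq vxy_neq path_interval (ltnW mn)).
  by apply: (divvar_stable_nzd sty); rewrite -/(yv m.+1) -s0E.
have pE : p = setvar0 (vx m.+1) p + divvar (vx m.+1) p * xv m.+1 by rewrite subrK.
rewrite pE; apply: idealD => //; apply: ideal_mulr => //.
apply: IH; first exact: leq_trans (msize_divvar (vx m.+1) p0) _.
apply: (divvar_stable_nzd stx).
have -> : divvar (vx m.+1) p * binom m m.+1 * 'X_(vx m.+1) =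
    p * binom m m.+1 - setvar0 (vx m.+1) p * binom m m.+1.
  by rewrite {2}pE /xv; ring.
by apply: idealB => //; apply: ideal_mulr.
Qed.

Lemma has_regularity_path m : (m < n)%N -> has_regularity (binom_ideal m.+1) m%:Z.
Proof.
elim: m => [|m IH] mn.
  apply: has_regularity_zero => p; split=> [|->]; last exact: ideal_gen0.
  by elim=> // a g q [i [j [ij j1 _ _]]]; lia.
have iJ := ideal_gen_ideal (binom_gen (K:=K) vx vy E m.+1).
rewrite (_ : m.+1%:Z = m%:Z + 1); last lia.
apply: (@has_regularity_adjoin _ _ _ _ (binom m m.+1) _ iJ); last by apply: IH; lia.
- exact: binom_homog.
- exact: binom_nzd.
move=> p; split.
  move: p; apply: ideal_gen_le; first exact: adjoin_ideal.
  move=> g [i [j [ij jm Eij ->]]].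
  have [j_lt|m_le] := ltnP j m.+1.
    by apply/adjoin_sub/ideal_gen_mem; exists i, j.
  have jE : j = m.+1 by lia.
  have iE : i = m by move: Eij; rewrite jE E_path; lia.
  by rewrite jE iE; apply: adjoin_gen.
move: p; apply: adjoin_le; first exact: ideal_gen_ideal.
  apply: ideal_gen_le; first exact: ideal_gen_ideal.
  move=> g [i [j [ij jm Eij ->]]]; apply: ideal_gen_mem; exists i, j.
  by split=> //; lia.
by apply: ideal_gen_mem; exists m, m.+1; rewrite E_path ?eqxx.
Qed.
End PathRegularity.

(** * Closed labelings *)

Lemma connect_lastP (T : finType) (r : rel T) i k : connect r i k ->
  i = k \/ exists2 k', connect r i k' & r k' k.
Proof.
case/connectP => p; case/lastP: p => [|p k'] /=; first by left.
rewrite rcons_path last_rcons => /andP[rp rk] ->; right.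
by exists (last i p) => //; apply/connectP; exists p.
Qed.

Lemma connect_headP (T : finType) (r : rel T) i k : connect r i k ->
  i = k \/ exists2 i', r i i' & connect r i' k.
Proof.
case/connectP => -[|i' p] /=; first by left.
by move=> /andP[ri rp] ->; right; exists i' => //; apply/connectP; exists p.
Qed.

Section ClosedLabeling.
Variables (n : nat) (E : rel 'I_n).
Hypotheses (E_sym : symmetric E) (E_closed : closed_labeling E).
Hypothesis E_conn : forall i j, connect E i j.

Definition ascent : rel 'I_n := fun i j => E i j && (i < j)%N.

Lemma connect_ascent_le (i j : 'I_n) : connect ascent i j -> (i <= j)%N.
Proof.
case/connectP => p; elim: p i => [|k p IH] i /=; first by move=> _ ->.
by move=> /andP[/andP[_ /ltnW ik] kp] /(IH k kp); apply: leq_trans.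
Qed.

(** Where a walk goes up to [k] from [k'] and then down to [j], closedness at [k]
gives the edge from [k'] to [j] and lowers the peak; [ascent_step_up] removes
valleys in the same way. *)
Lemma ascent_step_down (i j k : 'I_n) : connect ascent i k -> E k j -> (j < k)%N ->
  connect ascent i j || connect ascent j i.
Proof.
have [m] := ubnP (k : nat); elim: m k => // m IH k km ik Ekj jk.
have [->|[k' ik' /andP[Ekk' kk']]] := connect_lastP ik.
  by rewrite orbC connect1 // /ascent E_sym Ekj.
have [<-|ne_jk'] := eqVneq k' j; first by rewrite ik'.
have Ejk' : E k' j.
  by apply: (E_closed (i := k)) => //; rewrite 1?E_sym // kk' jk orbT.
case: (ltngtP k' j) => [lt_k'j|lt_jk'|/val_inj eq_k'j]; last by rewrite eq_k'j eqxx in ne_jk'.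
  by rewrite (connect_trans ik') // connect1 // /ascent Ejk'.
by apply: (IH k') => //; lia.
Qed.

Lemma ascent_step_up (i j k : 'I_n) : connect ascent k i -> E k j -> (k < j)%N ->
  connect ascent i j || connect ascent j i.
Proof.
have [m] := ubnP (n - k); elim: m k => // m IH k km ki Ekj kj.
have [<-|[k' /andP[Ekk' kk'] ki']] := connect_headP ki.
  by rewrite connect1 // /ascent Ekj.
have [<-|ne_jk'] := eqVneq k' j; first by rewrite ki' orbT.
have Ejk' : E k' j by apply: (E_closed (i := k)) => //; rewrite kk' kj.
case: (ltngtP k' j) => [lt_k'j|lt_jk'|/val_inj eq_k'j]; last by rewrite eq_k'j eqxx in ne_jk'.
  by apply: (IH k') => //; have := ltn_ord k'; lia.
rewrite orbC (connect_trans _ ki') // connect1 // /ascent E_sym Ejk'; exact: lt_jk'.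
Qed.

(** Removing peaks and valleys from a walk leaves a monotone one. *)
Lemma connect_ascent_total i j : connect ascent i j || connect ascent j i.
Proof.
have /connectP[p] := E_conn i j; elim/last_ind: p j => [|p j IH] k /=.
  by move=> _ ->; rewrite connect0.
rewrite rcons_path last_rcons => /andP[/IH/(_ erefl)] + + ->.
set k' := last i p => ik' Ek'j.
case: (ltngtP k' j) => [lt|gt|/val_inj <- //].
  case/orP: ik' => [ik'|k'i]; last exact: ascent_step_up k'i Ek'j lt.
  by rewrite (connect_trans ik') // connect1 // /ascent Ek'j.
case/orP: ik' => [ik'|k'i]; first exact: ascent_step_down ik' Ek'j gt.
by rewrite orbC (connect_trans _ k'i) // connect1 // /ascent E_sym Ek'j.
Qed.

(** Along an increasing walk from [i] to [k], closedness carries the edge to [j] from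
each vertex to the next; then [i] and [k] are both lower neighbours of [j]. *)
Lemma closed_labeling_interval (i k j : 'I_n) : (i < k)%N -> (k < j)%N -> E i j ->
  E i k /\ E k j.
Proof.
move=> ik kj Eij.
have up_ik : connect ascent i k.
  by case/orP: (connect_ascent_total i k) => // /connect_ascent_le; lia.
have Ekj : E k j.
  have [m] := ubnP (k : nat); elim: m k ik kj up_ik => // m IH k ik kj up_ik km.
  have [eq_ik|[k' up_k' /andP[Ek'k k'k]]] := connect_lastP up_ik.
    by rewrite eq_ik ltnn in ik.
  have Ek'j : E k' j.
    have [<- //|ne_ik'] := eqVneq i k'.
    have := connect_ascent_le up_k'; rewrite leq_eqVlt => /orP[/eqP/val_inj/eqP|ik'].
      by rewrite (negPf ne_ik').
    by apply: IH => //; lia.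
  apply: (E_closed Ek'k Ek'j); first by apply: contraTneq kj => ->; rewrite ltnn.
  by rewrite k'k (ltn_trans k'k kj).
split=> //; rewrite E_sym; apply: (E_closed (i := j)); rewrite 1?E_sym //.
  by apply: contraTneq ik => ->; rewrite ltnn.
by rewrite kj (ltn_trans ik kj) orbT.
Qed.
End ClosedLabeling.

(** * Comparison with the binomial edge ideal *)

Section Relabeling.
Import mpoly.
Variables (K : fieldType) (n : nat) (e : rel 'I_n.+1) (s : 'S_n.+1).
Hypothesis e_sym : ssrbool.symmetric e.
Local Notation N := (n.+1 + n.+1)%N.

(** Vertices in the order of the labeling [s], indexed by natural numbers; only
the values below [n + 1] matter. *)
Definition vertex (i : nat) : 'I_n.+1 := s (inord i).
Definition xindex i : 'I_N := lshift n.+1 (vertex i).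
Definition yindex i : 'I_N := rshift n.+1 (vertex i).
Definition relabeled : rel nat := fun i j => e (vertex i) (vertex j).

Lemma vertex_neq i j : (i < n.+1)%N -> (j < n.+1)%N -> i != j -> vertex i != vertex j.
Proof.
move=> i_lt j_lt; apply: contra_neq => /perm_inj ij.
by rewrite -(inordK i_lt) ij inordK.
Qed.

Lemma xindex_neq i j : (i < n.+1)%N -> (j < n.+1)%N -> i != j -> xindex i != xindex j.
Proof. by move=> *; rewrite (inj_eq (@lshift_inj _ _)) vertex_neq. Qed.

Lemma yindex_neq i j : (i < n.+1)%N -> (j < n.+1)%N -> i != j -> yindex i != yindex j.
Proof. by move=> *; rewrite (inj_eq (@rshift_inj _ _)) vertex_neq. Qed.

Lemma xyindex_neq i j : (i < n.+1)%N -> (j < n.+1)%N -> xindex i != yindex j.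
Proof. by move=> *; rewrite eq_lrshift. Qed.

Lemma binomial_edge_ideal_ideal : is_ideal (binomial_edge_ideal (K := K) e).
Proof.
split.
- by exists (fun _ _ => 0); rewrite big1 // => i _; rewrite big1 // => j _; rewrite mul0r.
- move=> _ _ [c ->] [d ->]; exists (fun i j => c i j + d i j).
  rewrite -big_split; apply: eq_bigr => i _; rewrite -big_split.
  by apply: eq_bigr => j _; rewrite mulrDl.
- move=> a _ [c ->]; exists (fun i j => a * c i j).
  rewrite mulr_sumr; apply: eq_bigr => i _; rewrite mulr_sumr.
  by apply: eq_bigr => j _; rewrite mulrA.
Qed.

Lemma binomial_edge_ideal_mem (i j : 'I_n.+1) : (i < j)%N -> e i j ->
  binomial_edge_ideal e (xvar K i * yvar K j - xvar K j * yvar K i).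
Proof.
move=> ij eij; exists (fun k l => ((k == i) && (l == j))%:R).
rewrite (bigD1 i) //= (bigD1 j) ?ij //= !eqxx mul1r big1 => [|k /andP[_ /negPf ->]]; last first.
  by rewrite andbF mul0r.
rewrite addr0 big1 ?addr0 // => k /negPf ->.
by rewrite big1 // => l _; rewrite mul0r.
Qed.

Lemma binomial_edge_idealE p :
  binom_ideal (K:=K) xindex yindex relabeled n.+1 p <-> binomial_edge_ideal e p.
Proof.
split.
  apply: ideal_gen_le; first exact: binomial_edge_ideal_ideal.
  move=> g [i [j [ij jn Eij ->]]].
  have : vertex i != vertex j by apply: vertex_neq; lia.
  rewrite /binom -/(xvar K (vertex i)) -/(yvar K (vertex j)).
  rewrite -/(xvar K (vertex j)) -/(yvar K (vertex i)).
  case: (ltngtP (vertex i) (vertex j)) => [lt|gt|/val_inj ->] ne_ij.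
  - exact: binomial_edge_ideal_mem.
  - rewrite -opprB; apply: idealN; first exact: binomial_edge_ideal_ideal.
    by apply: binomial_edge_ideal_mem; rewrite // e_sym.
  - by rewrite eqxx in ne_ij.
have iJ := ideal_gen_ideal (binom_gen (K:=K) xindex yindex relabeled n.+1).
case=> c ->; apply: ideal_sum => // i _; apply: ideal_sum => // j /andP[ij eij].
apply: idealM => //.
pose a : nat := s^-1%g i; pose b : nat := s^-1%g j.
have va : vertex a = i by rewrite /vertex inord_val permKV.
have vb : vertex b = j by rewrite /vertex inord_val permKV.
have ab : binom_gen (K:=K) xindex yindex relabeled n.+1 (binom K xindex yindex a b) \/
  binom_gen (K:=K) xindex yindex relabeled n.+1 (binom K xindex yindex b a).
  have [a_lt b_lt] : (a < n.+1)%N /\ (b < n.+1)%N by split; apply: ltn_ord.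
  case: (ltngtP a b) => [lt|gt|eq_ab].
  - by left; exists a, b; rewrite /relabeled va vb.
  - by right; exists b, a; rewrite /relabeled va vb e_sym.
  - by move: ij; rewrite -va -vb eq_ab ltnn.
have -> : xvar K i * yvar K j - xvar K j * yvar K i = binom K xindex yindex a b.
  by rewrite /binom /xv /yv /xindex /yindex va vb.
case: ab => [|]; first exact: ideal_gen_mem.
move/ideal_gen_mem; rewrite (_ : binom _ _ _ a b = - binom K xindex yindex b a).
  exact: idealN.
by rewrite /binom; ring.
Qed.
End Relabeling.

Theorem corollary2p7 (K : fieldType) (n : nat) (n_gt0 : (0 < n)%N)
    (e : rel 'I_n) (e_sym : symmetric e) (e_irr : irreflexive e)
    (e_conn : connected_graph e) (e_closed : closed_graph e) :
  has_regularity (binomial_edge_ideal (K := K) e) (n%:Z - 1) <-> path_graph e.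
Proof.
case: n n_gt0 e e_sym e_irr e_conn e_closed => // n _ e e_sym e_irr e_conn e_closed.
split; last first.
  case=> v vP; have Epath i j : (i < j)%N -> (j < n.+1)%N ->
      relabeled e v i j = (j == i.+1).
    move=> ij jn; rewrite /relabeled /vertex vP !inordK; try lia.
  have := has_regularity_path K (xindex_neq v) (yindex_neq v) (@xyindex_neq _ v) Epath (ltnSn n).
  rewrite (_ : n.+1%:Z - 1 = n%:Z); last lia.
  exact/has_regularity_ext/binomial_edge_idealE.
have [s sP] := e_closed.
pose E : rel 'I_n.+1 := fun i j => e (s i) (s j).
have E_conn i j : connect E i j.
  have /connectP[p] := e_conn (s i) (s j).
  elim: p i => [|k p IH] i /=; first by move=> _ /perm_inj ->.
  rewrite -[k](permKV s) => /andP[ik kp] jE.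
  by apply: connect_trans (IH _ kp jE); apply: connect1.
have E_sym : symmetric E by move=> i j; apply: e_sym.
have E_interval i k j : (i < k)%N -> (k < j)%N -> (j < n.+1)%N ->
    relabeled e s i j -> relabeled e s i k /\ relabeled e s k j.
  move=> ik kj jn; apply: (closed_labeling_interval E_sym sP E_conn);
    by rewrite !inordK; lia.
have TJ := koszul_reg_binom (K := K) (xindex_neq s) (yindex_neq s) (@xyindex_neq _ s)
  E_interval (ltn0Sn n).
have {}TJ := koszul_reg_ext (binomial_edge_idealE s e_sym) TJ.
case=> F [_ [l [k kE]]].
have low_ge : (n <= num_lowest n.+1 (relabeled e s) n)%N.
  have := resolution_shift_le (binomial_edge_ideal_ideal K e) k TJ.
  by rewrite kE /=; lia.
have Epath := num_lowest_path low_ge.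
exists s => i j; rewrite -[e _ _]/(E i j).
have relE (a b : 'I_n.+1) : (a < b)%N -> E a b = (b == a.+1 :> nat).
  by move=> ab; rewrite -(Epath a b ab (ltn_ord b)) /relabeled /vertex !inord_val.
case: (ltngtP i j) => [ij|ji|/val_inj ->].
- by rewrite relE //; lia.
- by rewrite E_sym relE //; lia.
- by rewrite /E e_irr; lia.
Qed.
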